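(* Under the standing assumptions listed in the context, for all power parameters $0<\alpha<1$ and all $\theta\in\Theta$, the influence function $\mathrm{IF}(x;T_\alpha,\theta)$ at $P_\theta\in\mathcal P$ of the power superdivergence estimator $\theta_{\alpha,n}=T_\alpha(P_n)$ coincides with the influence function $$\mathrm{IF}(x;T_0,\theta)=\boldsymbol I(\theta)^{-1}s_\theta(x)$$ of the maximum likelihood estimator $\theta_{0,n}=T_0(P_n)$, where $\boldsymbol I(\theta)=P_\theta\cdot s_\theta^{\rm t}s_\theta$.
   Context: Model: $(\mathcal X,\mathcal A)$ is a measurable space, $\Theta\subset\mathbb R^d$ is open, and $\mathcal P=\{P_\theta:\theta\in\Theta\}$ is a family of nonatomic probability measures with densities $p_\theta=\mathrm dP_\theta/\mathrm d\lambda$ with respect to a $\sigma$-finite $\lambda$, identifiable ($P_\theta\ne P_{\tilde\theta}$ if $\theta\ne\tilde\theta$) and measure-theoretically equivalent (products of densities $>0$ $\lambda$-a.s.). $P_0\notin\mathcal P$ is a probability measure equivalent with the members of $\mathcal P$; $\mathcal P^+=\mathcal P\cup\{P_0\}$; $\mathcal P_{\rm emp}$ is the set of empirical measures $P_n=\frac1n\sum_{i=1}^n\delta_{X_i}$; $\mathcal Q=\mathcal P^+\cup\mathcal P_{\rm emp}$. Write $Q\cdot f=\int f\,\mathrm dQ$, $Q_{\varepsilon,x}=(1-\varepsilon)Q+\varepsilon\delta_x$. For $0<\alpha<1$ let $$M_{\alpha,\theta}(Q,\tilde\theta)=\frac1{1-\alpha}P_{\tilde\theta}\cdot\left(\frac{p_\theta}{p_{\tilde\theta}}\right)^\alpha+\frac1\alpha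 Q\cdot\left(\frac{p_\theta}{p_{\tilde\theta}}\right)^\alpha ,$$ with all integrals finite; $\tilde T_{\alpha,\theta}(Q)=\mathrm{argmin}_{\tilde\theta}M_{\alpha,\theta}(Q,\tilde\theta)$, and $T_\alpha(Q)=\mathrm{argmax}_\theta M_{\alpha,\theta}(Q,\tilde T_{\alpha,\theta}(Q))$. The power superdivergence estimator is $\theta_{\alpha,n}=T_\alpha(P_n)$. For $\alpha=0$, $T_0(Q)=\mathrm{argmax}_\theta\,Q\cdot\ln p_\theta$. These functionals are considered for $Q\in\mathcal Q$ and for the mixtures $Q_{\varepsilon,x}$. The densities $p_\theta$ are twice differentiable in $\theta$, $s_\theta=\frac{\mathrm d}{\mathrm d\theta}\ln p_\theta$ (read as a column vector in the formula for IF; $s^{\rm t}s$ denotes the $d\times d$ matrix with entries $s_is_j$). It is assumed that $M_{\alpha,\theta}(Q,\tilde\theta)$ is twice differentiable in $\tilde\theta$, and that the argmin $\tilde T_{\alpha,\theta}(Q)$ exists and solves $P_{\tilde\theta}\cdot(p_\theta/p_{\tilde\theta})^\alpha s_{\tilde\theta}-Q\cdot(p_\theta/p_{\tilde\theta})^\alpha s_{\tilde\theta}=0$. It is understood that the argmax $T_\alpha(Q)$ exists, that $M_{\alpha,\theta}(Q,\tilde\theta)$ and $\tilde T_{\alpha,\theta}(Q_{\varepsilon,x})$ are sufficiently smooth in $\theta,\tilde\theta,\varepsilon$, that differentiation and integration are interchangeable where they occur, and that $\boldsymbol I(\theta)$ is invertible; the analogous regularity holds for $T_0$, which solves $Q\cdot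 s_\theta=0$. Influence function: $\mathrm{IF}(x;T,\theta)=\lim_{\varepsilon\downarrow0}\varepsilon^{-1}\left(T((1-\varepsilon)P_\theta+\varepsilon\delta_x)-T(P_\theta)\right)$, assumed to exist for all $x\in\mathcal X$. *)

(* Defs.v *)
(* R^d is represented by the column vectors (d may be 0). *)
From HB Require Import structures.
From mathcomp Require Export all_boot all_order all_algebra.
From mathcomp Require Export all_classical all_reals all_analysis.
Export Order.TTheory GRing.Theory Num.Theory numFieldNormedType.Exports.
Set Implicit Arguments.
Unset Strict Implicit.
Unset Printing Implicit Defensive.
#[export] Set Implicit Arguments.
#[export] Unset Strict Implicit.
#[export] Unset Printing Implicit Defensive.

Local Open Scope classical_set_scope.
Local Open Scope ring_scope.

Section Mixture.
Context {disp : measure_display} {X : measurableType disp} {R : realType}.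
Implicit Types (Q : probability X R) (e : R) (x : X).

Definition weight e : R := Num.max 0 (Num.min e 1).

Lemma weight_ge0 e : 0 <= weight e.
Proof. by rewrite /weight le_max lexx. Qed.

Lemma weight_le1 e : 0 <= 1 - weight e.
Proof. by rewrite subr_ge0 /weight ge_max ler01 ge_min lexx orbT. Qed.

Lemma weightE e : 0 <= e <= 1 -> weight e = e.
Proof. by case/andP=> e0 e1; rewrite /weight min_l // max_r. Qed.

(* (1 - e) Q + e \d_x for e in [0, 1]; e is first truncated to [0, 1] so that
   the result is a probability measure for every real e. *)
Definition mixture Q e x : set X -> \bar R :=
  measure_add (mscale (NngNum (weight_le1 e)) Q)
              (mscale (NngNum (weight_ge0 e)) (dirac x)).

HB.instance Definition _ Q e x := Measure.on (mixture Q e x).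

Lemma mixtureE Q e x (A : set X) : 0 <= e <= 1 ->
  mixture Q e x A = ((1 - e)%:E * Q A + e%:E * \d_x A)%E.
Proof.
move=> e01; rewrite /mixture measure_addE /mscale.
by congr (_%:E * _ + _%:E * _)%E; rewrite /= weightE.
Qed.

Lemma mixture_setT Q e x : mixture Q e x setT = 1%E.
Proof.
rewrite /mixture measure_addE /mscale.
rewrite [X in (_ * X + _)%E](probability_setT Q).
by rewrite [X in (_ + _ * X)%E](diracT R x) !mule1 -EFinD subrK.
Qed.

HB.instance Definition _ Q e x :=
  Measure_isProbability.Build _ _ _ (mixture Q e x) (mixture_setT Q e x).

End Mixture.

Section Generic.
Context {disp : measure_display} {X : measurableType disp} {R : realType}.

Definition nonatomic (mu : set X -> \bar R) : Prop :=
  forall A, measurable A -> (0 < mu A)%E ->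
    exists B, [/\ measurable B, B `<=` A, (0 < mu B)%E & (mu B < mu A)%E].

Definition empirical (Q : probability X R) : Prop :=
  exists (n : nat) (xs : 'I_n.+1 -> X), forall A, measurable A ->
    Q A = (n.+1%:R^-1%:E * \sum_(i < n.+1) \d_(xs i) A)%E.

Definition twice_differentiable (V : normedModType R) (U : set V)
    (f : V -> R) : Prop :=
  (forall y, U y -> differentiable f y) /\
  (forall v y, U y -> differentiable ('D_v f) y).

(* The directional derivatives of y |-> \int F y x dmu(x) on U may be computed
   under the integral sign, all integrals involved being finite. *)
Definition diff_under_integral (mu : {measure set X -> \bar R})
    (V : normedModType R) (U : set V) (F : V -> X -> R) : Prop :=
  forall v y, U y ->
  [/\ mu.-integrable setT (EFin \o F y),
      mu.-integrable setT (fun x => ('D_v (F ^~ x) y)%:E),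
      derivable (fun z => \int[mu]_x F z x) y v &
      'D_v (fun z => \int[mu]_x F z x) y = \int[mu]_x 'D_v (F ^~ x) y].

Definition twice_diff_under_integral (mu : {measure set X -> \bar R})
    (V : normedModType R) (U : set V) (F : V -> X -> R) : Prop :=
  diff_under_integral mu U F /\
  forall v, diff_under_integral mu U (fun y x => 'D_v (F ^~ x) y).

Definition is_argmin (S : Type) (D : set S) (f : S -> R) (s : S) : Prop :=
  D s /\ forall t, D t -> f s <= f t.

Definition is_argmax (S : Type) (D : set S) (f : S -> R) (s : S) : Prop :=
  D s /\ forall t, D t -> f t <= f s.

Definition IF_quotient (V : normedModType R) (T : probability X R -> V)
    (Q : probability X R) (x : X) (e : R) : V :=
  e^-1 *: (T (mixture Q e x) - T Q).

Definition IF_exists (V : normedModType R) (T : probability X R -> V)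
    (Q : probability X R) (x : X) : Prop :=
  cvg (IF_quotient T Q x e @[e --> 0^'+]).

Definition IF (V : normedModType R) (T : probability X R -> V)
    (Q : probability X R) (x : X) : V :=
  lim (IF_quotient T Q x e @[e --> 0^'+]).

End Generic.

Section Model.
Context {disp : measure_display} {X : measurableType disp} {R : realType}.
Context {d : nat}.
Variables (Theta : set 'cV[R]_d).
Variables (lambda : {sigma_finite_measure set X -> \bar R}).
Variables (p : 'cV[R]_d -> X -> R) (P : 'cV[R]_d -> probability X R).
Variables (P0 : probability X R).
Implicit Types (theta eta : 'cV[R]_d) (x : X) (Q : probability X R).

Definition score theta x : 'cV[R]_d :=
  \col_(i < d) 'D_(delta_mx i 0) (fun t => ln (p t x)) theta.

Definition fisher theta : 'M[R]_d :=
  \matrix_(i < d, j < d) \int[P theta]_x (score theta x i 0 * score theta x j 0).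

Definition ratio_pow (alpha : R) theta eta x : R :=
  (p theta x / p eta x) `^ alpha.

Definition M (alpha : R) theta Q eta : R :=
  (1 - alpha)^-1 * \int[P eta]_x ratio_pow alpha theta eta x
  + alpha^-1 * \int[Q]_x ratio_pow alpha theta eta x.

(* Measures of the library are functions on all sets, hence equality of
   probability laws is tested on measurable sets only. *)
Definition same_law Q Q' : Prop := forall A, measurable A -> Q A = Q' A.

(* Outside Theta, p and P are unconstrained. *)
Record model : Prop := {
  model_open : open Theta;
  model_measurable : forall theta, Theta theta -> measurable_fun setT (p theta);
  model_ge0 : forall theta x, Theta theta -> 0 <= p theta x;
  model_density : forall theta A, Theta theta -> measurable A ->
    P theta A = (\int[lambda]_(x in A) (p theta x)%:E)%E;
  model_nonatomic : forall theta, Theta theta -> nonatomic (P theta);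
  model_identifiable : forall theta eta, Theta theta -> Theta eta ->
    theta <> eta -> ~ same_law (P theta) (P eta);
  model_equivalent : forall theta eta, Theta theta -> Theta eta ->
    {ae lambda, forall x, 0 < p theta x * p eta x};
  model_P0_notin : forall theta, Theta theta -> ~ same_law P0 (P theta);
  model_P0_equivalent : forall theta, Theta theta ->
    P0 `<< P theta /\ P theta `<< P0
}.

(* P^+ together with the empirical measures *)
Definition calQ : set (probability X R) :=
  [set Q | (exists2 theta, Theta theta & Q = P theta) \/ Q = P0 \/ empirical Q].

Definition calQ_mix : set (probability X R) :=
  calQ `|`
  [set Q | exists Q' e x, [/\ calQ Q', 0 <= e <= 1 & Q = mixture Q' e x]].

Record smooth_densities : Prop := {
  density_twice_diff : forall x, twice_differentiable Theta (p ^~ x);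
  density_interchange : twice_diff_under_integral lambda Theta p;
  fisher_integrable : forall theta i j, Theta theta ->
    (P theta).-integrable setT
      (fun x => (score theta x i 0 * score theta x j 0)%:E);
  fisher_unit : forall theta, Theta theta -> fisher theta \in unitmx
}.

(* Joint smoothness of (theta, eta) |-> M theta Q eta contains its smoothness
   in eta alone; M is affine in e along mixtures.  The mixtures only exist for
   e >= 0, so smoothness in (theta, e) of the minimizer at a point (theta, 0)
   is that of an extension to a full neighbourhood of this point.  The score at
   x of P theta0 is only meaningful if 0 < p theta0 x, whence this guard. *)
Record power_assumptions (alpha : R)
    (Ttilde : 'cV[R]_d -> probability X R -> 'cV[R]_d)
    (T : probability X R -> 'cV[R]_d) : Prop := {
  power_integrable : forall theta eta Q, Theta theta -> Theta eta ->
    calQ_mix Q -> Q.-integrable setT (EFin \o ratio_pow alpha theta eta);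
  power_twice_diff : forall Q, calQ_mix Q ->
    twice_differentiable (Theta `*` Theta) (fun y => M alpha y.1 Q y.2);
  power_interchange_model : twice_diff_under_integral lambda (Theta `*` Theta)
    (fun y x => p y.2 x * ratio_pow alpha y.1 y.2 x);
  power_interchange : forall theta0, Theta theta0 ->
    twice_diff_under_integral (P theta0) (Theta `*` Theta)
      (fun y x => ratio_pow alpha y.1 y.2 x);
  power_argmin : forall theta Q, Theta theta -> calQ_mix Q ->
    is_argmin Theta (M alpha theta Q) (Ttilde theta Q);
  power_estimating_eq : forall theta Q i, Theta theta -> calQ_mix Q ->
    let eta := Ttilde theta Q in
    let g x := ratio_pow alpha theta eta x * score eta x i 0 in
    [/\ (P eta).-integrable setT (EFin \o g), Q.-integrable setT (EFin \o g) &
        \int[P eta]_x g x - \int[Q]_x g x = 0];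
  power_argmax : forall Q, calQ_mix Q ->
    is_argmax Theta (fun theta => M alpha theta Q (Ttilde theta Q)) (T Q);
  power_argmin_smooth : forall theta0 x, Theta theta0 -> 0 < p theta0 x ->
    exists g : 'cV[R]_d * R -> 'cV[R]_d,
      \forall y \near (theta0, 0 : R), differentiable g y /\
        (0 <= y.2 -> g y = Ttilde y.1 (mixture (P theta0) y.2 x));
  power_IF_exists : forall theta x, Theta theta -> 0 < p theta x ->
    IF_exists T (P theta) x
}.

Record mle_assumptions (T0 : probability X R -> 'cV[R]_d) : Prop := {
  mle_integrable : forall theta Q, Theta theta -> calQ_mix Q ->
    Q.-integrable setT (fun x => (ln (p theta x))%:E);
  mle_twice_diff : forall Q, calQ_mix Q ->
    twice_differentiable Theta (fun theta => \int[Q]_x ln (p theta x));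
  mle_interchange : forall theta0, Theta theta0 ->
    twice_diff_under_integral (P theta0) Theta (fun theta x => ln (p theta x));
  mle_argmax : forall Q, calQ_mix Q ->
    is_argmax Theta (fun theta => \int[Q]_x ln (p theta x)) (T0 Q);
  mle_estimating_eq : forall Q i, calQ_mix Q ->
    Q.-integrable setT (fun x => (score (T0 Q) x i 0)%:E) /\
    \int[Q]_x score (T0 Q) x i 0 = 0;
  mle_IF_exists : forall theta x, Theta theta -> 0 < p theta x ->
    IF_exists T0 (P theta) x
}.

End Model.

(* Main.v *)
Require Import Defs.
From mathcomp Require Import measurable_realfun ring lra.

Local Open Scope classical_set_scope.
Local Open Scope ring_scope.

(** Both estimators are roots, along the contaminated laws [Q_e = (1 - e)
    P_theta + e \d_x], of an equation that is affine in [e]. If [Phi_0 + e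
    (Phi_1 - Phi_0)] vanishes at [y_e], if [Phi_0] vanishes at [y_0], and if
    [(y_e - y_0) / e] tends to [k], then differentiating at [e = 0] gives
    ['D_k Phi_0 (y_0) + Phi_1 (y_0) = 0]; this uses that [Phi_0] is
    differentiable and [Phi_1] continuous at [y_0] ([zero_curve_derive]).
    Since the influence functions are assumed to exist, it suffices to compute
    the two terms, and in both cases the outcome is [I h = s], where [h] is
    the influence function, [I] the Fisher information and [s] the score at
    [x].

    For maximum likelihood, [Phi] is the derivative of the expected
    log-likelihood, and the computation is the information identity [\int p
    D_u D_v ln p = - \int p (D_u ln p) (D_v ln p)], which holds because [\int
    D_u D_v p = 0] ([Rintegral_bartlett]).

    For the superdivergence estimator the unknown is the pair [(theta_e,
    eta_e)] of the outer maximizer and the inner minimizer. The dependence of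
    [eta_e] on [theta] is eliminated by the envelope principle: the criterion
    [M] is stationary in [eta] at an inner minimizer, hence maximizing [theta
    |-> M (theta, eta (theta))] makes the partial derivative of [M] in [theta]
    vanish ([envelope], [power_critical]). So [Phi] is this partial
    derivative, as a function on pairs. With [l = ln p], the integrands of
    [M], with respect to [lambda] and to [P_theta], are [exp (a l_theta + b
    l_eta)], with [a = alpha] and [b = 1 - alpha] or [b = - alpha]
    ([exp_log]). Their second derivatives at [(theta, theta)] are explicit,
    and in the weighted sum defining [M] the terms in the direction of [eta]
    cancel: the inner minimizer has no first-order effect
    ([superdivergence_derive2]). What remains is [- p (D_u l) (D_v l)] plus a
    multiple of [D_u D_v p], as for maximum likelihood.

    The curves have to start at [theta], that is, the functionals have to be
    Fisher consistent. For [T_0] this is the positivity of the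
    Kullback-Leibler divergence. For [T_alpha] it follows from two uses of the
    weighted inequality of arithmetic and geometric means, one showing that,
    for the outer parameter [theta], the inner criterion at [P_theta] is
    minimal at [eta = theta], and one bounding the affinity [\int p_t^alpha
    p_theta^(1 - alpha)] by [1] in the outer maximization. All equality cases
    are settled by the strict tangent inequality of the exponential and by
    identifiability. *)

(** * Integrals of real functions, mixtures and densities *)

Section RealIntegral.
Context {disp : measure_display} {X : measurableType disp} {R : realType}.
Implicit Types (mu : {measure set X -> \bar R}) (Q : probability X R) (e : R).

Lemma Rintegral_funeposneg mu (f : X -> R) :
  mu.-integrable setT (EFin \o f) ->
  \int[mu]_y f y =
  fine (\int[mu]_y (EFin \o f)^\+ y)%E - fine (\int[mu]_y (EFin \o f)^\- y)%E.
Proof.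
move=> fi; rewrite /Rintegral -/(EFin \o f) integralE fineB//.
  exact: integrable_pos_fin_num.
exact: integrable_neg_fin_num.
Qed.

(** A real integral is the difference of the integrals of the positive and the
    negative parts; each of these is additive in the measure. *)
Lemma Rintegral_mixture Q e x (f : X -> R) : 0 <= e <= 1 ->
  Q.-integrable setT (EFin \o f) ->
  \int[mixture Q e x]_y f y = (1 - e) * \int[Q]_y f y + e * f x.
Proof.
move=> e01 fi; have mf := measurable_int _ fi.
pose F y : \bar R := (f y)%:E.
have mFp : measurable_fun setT (F^\+)%E by exact: measurable_funepos.
have mFn : measurable_fun setT (F^\-)%E by exact: measurable_funeneg.
have intm (g : X -> \bar R) : measurable_fun setT g ->
    (forall y, 0 <= g y)%E ->
    (\int[mixture Q e x]_y g y = (1 - e)%:E * \int[Q]_y g y + e%:E * g x)%E.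
  move=> mg g0; rewrite ge0_integral_measure_add//.
  rewrite !ge0_integral_mscale//.
  by rewrite integral_dirac// diracT mul1e /= weightE.
have QFp : (\int[Q]_y F^\+ y)%E \is a fin_num.
  exact: integrable_pos_fin_num fi.
have QFn : (\int[Q]_y F^\- y)%E \is a fin_num.
  exact: integrable_neg_fin_num fi.
have Fp : (F^\+ x)%E = (Num.max (f x) 0)%:E by rewrite funeposE EFin_max.
have Fn : (F^\- x)%E = (Num.max (- f x) 0)%:E by rewrite funenegE EFin_max.
rewrite (Rintegral_funeposneg fi) /Rintegral -/F.
rewrite integralE !intm// Fp Fn -(fineK QFp) -(fineK QFn) -!EFinM -!EFinD /=.
have -> : e * f x = e * (Num.max (f x) 0 - Num.max (- f x) 0).
  by congr (_ * _); rewrite !maxEle; case: ifPn; case: ifPn; lra.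
by rewrite /comp -/F; ring.
Qed.

Lemma integrable_addr mu (f g : X -> R) :
  mu.-integrable setT (EFin \o f) -> mu.-integrable setT (EFin \o g) ->
  mu.-integrable setT (EFin \o (fun x => f x + g x)).
Proof. by move=> fi gi; exact: (integrableD measurableT fi gi). Qed.

Lemma integrable_subr mu (f g : X -> R) :
  mu.-integrable setT (EFin \o f) -> mu.-integrable setT (EFin \o g) ->
  mu.-integrable setT (EFin \o (fun x => f x - g x)).
Proof. by move=> fi gi; exact: (integrableB measurableT fi gi). Qed.

Lemma integrable_mull mu (a : R) (f : X -> R) :
  mu.-integrable setT (EFin \o f) ->
  mu.-integrable setT (EFin \o (fun x => a * f x)).
Proof. by move=> fi; exact: (integrableZl measurableT a fi). Qed.

Lemma integrable_lincomb mu (I : Type) (s : seq I) (c : I -> R)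
    (f : I -> X -> R) :
  (forall i, mu.-integrable setT (EFin \o f i)) ->
  mu.-integrable setT (EFin \o (fun x => \sum_(i <- s) c i * f i x)).
Proof.
move=> fi; elim: s => [|i s IH].
  by under eq_fun do rewrite big_nil; exact: integrable0.
rewrite (_ : EFin \o _ = EFin \o (fun x => c i * f i x
    + \sum_(j <- s) c j * f j x)); last first.
  by apply/funext => x /=; rewrite big_cons.
by apply: integrable_addr => //; exact: integrable_mull.
Qed.

Lemma Rintegral_lincomb mu (I : Type) (s : seq I) (c : I -> R)
    (f : I -> X -> R) :
  (forall i, mu.-integrable setT (EFin \o f i)) ->
  \int[mu]_x \sum_(i <- s) c i * f i x = \sum_(i <- s) c i * \int[mu]_x f i x.
Proof.
move=> fi; elim: s => [|i s IH].
  rewrite big_nil; under eq_Rintegral do rewrite big_nil.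
  by rewrite /Rintegral integral0.
rewrite big_cons -IH; under eq_Rintegral do rewrite big_cons.
rewrite RintegralD//; first by rewrite RintegralZl.
- exact: integrable_mull.
- exact: integrable_lincomb.
Qed.

End RealIntegral.

Section Density.
Context {disp : measure_display} {X : measurableType disp} {R : realType}.
Context (lambda : {sigma_finite_measure set X -> \bar R}) (Q : probability X R).
Context (p : X -> R).
Hypothesis mp : measurable_fun setT p.
Hypothesis p_ge0 : forall x, 0 <= p x.
Hypothesis Qp : forall A, measurable A ->
  Q A = (\int[lambda]_(x in A) (p x)%:E)%E.


Local Notation rn := (Radon_Nikodym_SigmaFinite.f Q lambda).

Lemma density_dominates : Q `<< lambda.
Proof.
apply/null_content_dominatesP => A mA A0; rewrite Qp// null_set_integral//.
exact/measurable_funTS/measurable_EFinP.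
Qed.

(** This transfers to [p] the change of variables that is known for the chosen
    Radon-Nikodym derivative. *)
Lemma density_radon_nikodym : ae_eq lambda setT rn (EFin \o p).
Proof.
apply: integral_ae_eq => //.
- exact: Radon_Nikodym_SigmaFinite.f_integrable density_dominates.
- exact/measurable_EFinP.
- move=> A _ mA.
  apply: etrans (Qp mA); apply/esym.
  exact: Radon_Nikodym_SigmaFinite.f_integral density_dominates _ mA.
Qed.

Lemma ge0_integral_density (f : X -> \bar R) : measurable_fun setT f ->
  (forall x, 0 <= f x)%E ->
  (\int[Q]_x f x = \int[lambda]_x (f x * (p x)%:E))%E.
Proof.
move=> mf f0.
rewrite -(Radon_Nikodym_SigmaFinite.change_of_variables density_dominates f0)//.
apply: ae_eq_integral => //.
- apply: emeasurable_funM => //; apply: (measurable_int lambda).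
  exact: Radon_Nikodym_SigmaFinite.f_integrable density_dominates.
- by apply: emeasurable_funM => //; exact/measurable_EFinP.
- exact/ae_eqe_mul2l/density_radon_nikodym.
Qed.

Lemma integrable_density (f : X -> R) : Q.-integrable setT (EFin \o f) ->
  lambda.-integrable setT (fun x => (f x * p x)%:E).
Proof.
move=> /integrableP[/measurable_EFinP mf foo]; apply/integrableP; split.
  by apply/measurable_EFinP; exact: measurable_funM.
under eq_integral do rewrite EFinM abseM (gee0_abs (x := (p _)%:E)) ?lee_fin//.
rewrite -ge0_integral_density//.
by apply: measurableT_comp => //; exact/measurable_EFinP.
Qed.

Lemma Rintegral_density (f : X -> R) : Q.-integrable setT (EFin \o f) ->
  \int[Q]_x f x = \int[lambda]_x (f x * p x).
Proof.
move=> fi; have fpi := integrable_density fi.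
have mf := measurable_int _ fi.
rewrite !Rintegral_funeposneg// !ge0_integral_density//; last 2 first.
- exact: measurable_funeneg.
- exact: measurable_funepos.
congr (fine _ - fine _); apply: eq_integral => x _.
  by rewrite !funeposE /= -!EFin_max -EFinM maxr_pMl// mul0r.
by rewrite !funenegE /= -!EFin_max -EFinM maxr_pMl// mul0r mulNr.
Qed.

Lemma density_probability :
  lambda.-integrable setT (EFin \o p) /\ \int[lambda]_x p x = 1.
Proof.
have p1 : (\int[lambda]_x (p x)%:E = 1)%E by rewrite -Qp// probability_setT.
split; last by rewrite /Rintegral p1.
apply/integrableP; split; first exact/measurable_EFinP.
by under eq_integral do rewrite gee0_abs ?lee_fin//; rewrite /= p1 ltry.
Qed.

End Density.

Lemma ae_eq_Rintegral {disp : measure_display} {X : measurableType disp}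
    {R : realType} (mu : {measure set X -> \bar R}) (f g : X -> R) :
  measurable_fun setT f -> measurable_fun setT g ->
  {ae mu, forall x, f x = g x} -> \int[mu]_x f x = \int[mu]_x g x.
Proof.
move=> mf mg fg; congr fine; apply: ae_eq_integral => //.
- exact/measurable_EFinP.
- exact/measurable_EFinP.
- by apply: filterS fg => x fgx _; rewrite fgx.
Qed.

(** The source of all equality cases below: pointwise inequalities are turned
    into almost everywhere equalities. *)
Lemma ae_eq0_of_Rintegral_le0 {disp : measure_display}
    {X : measurableType disp} {R : realType} (mu : {measure set X -> \bar R})
    (f : X -> R) :
  mu.-integrable setT (EFin \o f) -> {ae mu, forall x, 0 <= f x} ->
  \int[mu]_x f x <= 0 -> {ae mu, forall x, f x = 0}.
Proof.
move=> fi f0 If.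
have mf := measurable_int _ fi.
have /measurable_EFinP mf' := mf.
have : (\int[mu]_x `|(f x)%:E| = 0)%E.
  rewrite (ae_eq_integral (EFin \o f))//; last 2 first.
  - exact: measurableT_comp.
  - by apply: filterS f0 => x fx _ /=; rewrite ger0_norm.
  rewrite -[LHS]fineK; last exact: integrable_fin_num.
  congr (_%:E); apply/eqP; rewrite eq_le [X in X && _]If/= -/(Rintegral _ _ _).
  suff <- : \int[mu]_x `|f x| = \int[mu]_x f x.
    exact: Rintegral_ge0.
  apply: ae_eq_Rintegral => //; first exact: measurableT_comp.
  by apply: filterS f0 => x fx; rewrite ger0_norm.
move=> /ae_eq_integral_abs => /(_ measurableT mf) f_ae.
by apply: filterS f_ae => x /(_ I) [].
Qed.

(** * Identification of the parameter by convexity *)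

Section Convexity.
Context {R : realType}.
Implicit Types a u v : R.

Lemma expR_tangent_le u v : expR v + expR v * (u - v) <= expR u.
Proof.
have -> : expR u = expR v * expR (u - v) by rewrite -expRD; congr expR; ring.
rewrite -[X in X + _]mulr1 -mulrDr ler_pM2l ?expR_gt0//.
by rewrite expR_ge1Dx.
Qed.

Lemma expR_tangent_eq u v : expR v + expR v * (u - v) = expR u -> u = v.
Proof.
have -> : expR u = expR v * expR (u - v) by rewrite -expRD; congr expR; ring.
rewrite -[X in X + _]mulr1 -mulrDr => /mulfI -/(_ (lt0r_neq0 (expR_gt0 _))) uv.
apply/eqP; rewrite -subr_eq0; apply: contra_eqT uv => /expR_gt1Dx.
by move=> /lt_eqF/negbT.
Qed.

(** The inequality of weighted means, in logarithmic coordinates: average the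
    tangent inequalities at the mean [w] of [u] and [v]. *)
Lemma expR_weighted_le a u v : 0 < a < 1 ->
  expR (a * u + (1 - a) * v) <= a * expR u + (1 - a) * expR v.
Proof.
move=> /andP[a0 a1]; set w := a * u + (1 - a) * v.
have hu := ler_wpM2l (ltW a0) (expR_tangent_le u w).
have a1' : 0 <= 1 - a by lra.
have hv := ler_wpM2l a1' (expR_tangent_le v w).
apply: le_trans (lerD hu hv); rewrite le_eqVlt; apply/orP; left; apply/eqP.
by rewrite /w; ring.
Qed.

Lemma expR_weighted_eq a u v : 0 < a < 1 ->
  expR (a * u + (1 - a) * v) = a * expR u + (1 - a) * expR v -> u = v.
Proof.
move=> /andP[a0 a1]; set w := a * u + (1 - a) * v => eq_w.
have a1' : 0 < 1 - a by lra.
have hu := expR_tangent_le u w; have hv := expR_tangent_le v w.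
have sum0 : a * (expR u - (expR w + expR w * (u - w)))
  + (1 - a) * (expR v - (expR w + expR w * (v - w))) = 0.
  have -> : a * (expR u - (expR w + expR w * (u - w)))
      + (1 - a) * (expR v - (expR w + expR w * (v - w)))
      = a * expR u + (1 - a) * expR v - expR w
        - expR w * (a * u + (1 - a) * v - w).
    by ring.
  by rewrite -eq_w -/w; ring.
move: sum0 => /eqP; rewrite paddr_eq0; last 2 first.
- by rewrite mulr_ge0// ?subr_ge0// ltW.
- by rewrite mulr_ge0// ?subr_ge0// ltW.
rewrite !mulf_eq0 (gt_eqF a0) (gt_eqF a1') /= !subr_eq0.
move=> /andP[/eqP eu /eqP ev].
by rewrite (expR_tangent_eq (esym eu)) (expR_tangent_eq (esym ev)).
Qed.

End Convexity.

Section Identification.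
Context {disp : measure_display} {X : measurableType disp} {R : realType}.
Context {d : nat} {Theta : set 'cV[R]_d}.
Context {lambda : {sigma_finite_measure set X -> \bar R}}.
Context {p : 'cV[R]_d -> X -> R} {P : 'cV[R]_d -> probability X R}.
Context {P0 : probability X R}.
Hypothesis Hmodel : model Theta lambda p P P0.
Implicit Types (theta eta : 'cV[R]_d) (x : X).

Lemma density_gt0 theta : Theta theta -> {ae lambda, forall x, 0 < p theta x}.
Proof.
move=> Tt; apply: filterS (model_equivalent Hmodel Tt Tt) => x pp.
rewrite lt_neqAle (model_ge0 Hmodel x Tt) andbT.
apply: contraTneq pp => <-; by rewrite mul0r ltxx.
Qed.

Lemma model_integrable_density theta (f : X -> R) : Theta theta ->
  (P theta).-integrable setT (EFin \o f) ->
  lambda.-integrable setT (EFin \o (fun x => f x * p theta x)).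
Proof.
move=> Tt; apply: integrable_density.
- exact: model_measurable Hmodel _ Tt.
- by move=> x; exact: model_ge0 Hmodel _ _ Tt.
- by move=> A; exact: model_density Hmodel _ _ Tt.
Qed.

Lemma model_Rintegral_density theta (f : X -> R) : Theta theta ->
  (P theta).-integrable setT (EFin \o f) ->
  \int[P theta]_x f x = \int[lambda]_x (f x * p theta x).
Proof.
move=> Tt; apply: Rintegral_density.
- exact: model_measurable Hmodel _ Tt.
- by move=> x; exact: model_ge0 Hmodel _ _ Tt.
- by move=> A; exact: model_density Hmodel _ _ Tt.
Qed.

Lemma model_density_probability theta : Theta theta ->
  lambda.-integrable setT (EFin \o p theta) /\ \int[lambda]_x p theta x = 1.
Proof.
move=> Tt; apply: (@density_probability _ _ _ _ (P theta)).
- exact: model_measurable Hmodel _ Tt.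
- by move=> x; exact: model_ge0 Hmodel _ _ Tt.
- by move=> A; exact: model_density Hmodel _ _ Tt.
Qed.

(** A gap function [f] between the two densities, nonnegative and vanishing
    only where they agree, can have a nonpositive integral only if the laws
    are equal. *)
Lemma density_identify theta eta (f : X -> R) : Theta theta -> Theta eta ->
  lambda.-integrable setT (EFin \o f) -> \int[lambda]_x f x <= 0 ->
  (forall x, 0 < p theta x -> 0 < p eta x ->
    0 <= f x /\ (f x = 0 -> p eta x = p theta x)) ->
  eta = theta.
Proof.
move=> Tt Te fi If fP.
have pt := density_gt0 Tt; have pe := density_gt0 Te.
have f0 : {ae lambda, forall x, f x = 0}.
  apply: ae_eq0_of_Rintegral_le0 => //.
  by apply: filterS2 pt pe => x ptx pex; have [] := fP x ptx pex.
apply: contrapT => ne; apply: (model_identifiable Hmodel Te Tt ne) => A mA.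
rewrite !(model_density Hmodel)//; apply: ae_eq_integral => //.
- exact/measurable_funTS/measurable_EFinP/(model_measurable Hmodel Te).
- exact/measurable_funTS/measurable_EFinP/(model_measurable Hmodel Tt).
- apply: filterS3 f0 pt pe => x fx0 ptx pex _; congr (_%:E).
  by have [_ ->] := fP x ptx pex.
Qed.

Lemma expR_ln_density theta x :
  0 < p theta x -> expR (ln (p theta x)) = p theta x.
Proof. by move=> ?; rewrite lnK. Qed.

(** Positivity of the Kullback-Leibler divergence. The gap function is [p_eta
    - p_theta - p_theta (ln p_eta - ln p_theta)], nonnegative by the tangent
    inequality of the exponential. *)
Lemma likelihood_identify theta eta : Theta theta -> Theta eta ->
  (P theta).-integrable setT (fun x => (ln (p theta x))%:E) ->
  (P theta).-integrable setT (fun x => (ln (p eta x))%:E) ->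
  \int[P theta]_x ln (p theta x) <= \int[P theta]_x ln (p eta x) ->
  eta = theta.
Proof.
move=> Tt Te it ie le_int.
have [pti pt1] := model_density_probability Tt.
have [pei pe1] := model_density_probability Te.
have iet := model_integrable_density Tt ie.
have itt := model_integrable_density Tt it.
pose g x := ln (p eta x) * p theta x - ln (p theta x) * p theta x.
have gi : lambda.-integrable setT (EFin \o g) by exact: integrable_subr.
have eg : \int[lambda]_x g x
    = \int[P theta]_x ln (p eta x) - \int[P theta]_x ln (p theta x).
  by rewrite /g RintegralB// -!model_Rintegral_density.
pose k x := p theta x + g x.
have ki : lambda.-integrable setT (EFin \o k) by exact: integrable_addr.
have ek : \int[lambda]_x k x = 1 + \int[lambda]_x g x.
  by rewrite /k RintegralD// pt1.
apply: (@density_identify _ _ (fun x => p eta x - k x)) => //.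
- exact: integrable_subr.
- by rewrite RintegralB// pe1 ek eg; lra.
move=> x ptx pex.
have := expR_tangent_le (ln (p eta x)) (ln (p theta x)).
have := @expR_tangent_eq _ (ln (p eta x)) (ln (p theta x)).
rewrite !expR_ln_density// => eq_tan le_tan; split.
  by rewrite /k /g; lra.
move=> e0; apply: (@ln_inj R) => //; apply: eq_tan.
by move: e0; rewrite /k /g; lra.
Qed.

Variable alpha : R.
Hypothesis alpha01 : 0 < alpha < 1.
Local Notation r := (ratio_pow p alpha).

Lemma ratio_powE theta eta x : 0 < p theta x -> 0 < p eta x ->
  r theta eta x = expR (alpha * (ln (p theta x) - ln (p eta x))).
Proof.
move=> pt pe; rewrite /ratio_pow /powR gt_eqF ?divr_gt0//.
by rewrite ln_div.
Qed.

(** The integral is the affinity [\int p_theta^alpha p_eta^(1 - alpha)], and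
    the gap function is the difference of the arithmetic and the geometric
    means of the two densities. *)
Lemma ratio_pow_affinity theta eta : Theta theta -> Theta eta ->
  (P eta).-integrable setT (EFin \o r theta eta) ->
  \int[P eta]_x r theta eta x <= 1 /\
  (1 <= \int[P eta]_x r theta eta x -> theta = eta).
Proof.
move=> Tt Te ri; have /andP[a0 a1] := alpha01.
have [pti pt1] := model_density_probability Tt.
have [pei pe1] := model_density_probability Te.
have rip := model_integrable_density Te ri.
have ati := integrable_mull alpha pti.
have aei := integrable_mull (1 - alpha) pei.
pose k x := alpha * p theta x + (1 - alpha) * p eta x.
have ki : lambda.-integrable setT (EFin \o k) by exact: integrable_addr.
have ek : \int[lambda]_x k x = 1.
  by rewrite /k RintegralD// !RintegralZl// pt1 pe1; ring.
pose f x := k x - r theta eta x * p eta x.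
have fi : lambda.-integrable setT (EFin \o f) by exact: integrable_subr.
have ef : \int[lambda]_x f x = 1 - \int[P eta]_x r theta eta x.
  by rewrite /f RintegralB// ek -model_Rintegral_density.
have fP x : 0 < p eta x -> 0 < p theta x ->
    0 <= f x /\ (f x = 0 -> p theta x = p eta x).
  move=> pex ptx.
  have rE : r theta eta x * p eta x =
      expR (alpha * ln (p theta x) + (1 - alpha) * ln (p eta x)).
    rewrite ratio_powE// -[X in _ * X]expR_ln_density// -expRD.
    by congr expR; ring.
  have := expR_weighted_le (ln (p theta x)) (ln (p eta x)) alpha01.
  have := @expR_weighted_eq _ _ (ln (p theta x)) (ln (p eta x)) alpha01.
  rewrite -rE !expR_ln_density// => eq_w le_w; rewrite /f /k.
  split; first by lra.
  by move=> e0; apply: (@ln_inj R) => //; apply: eq_w; lra.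
have idf : \int[lambda]_x f x <= 0 -> theta = eta.
  by move=> If; apply: (density_identify Te Tt fi).
split; last by move=> ?; apply: idf; rewrite ef; lra.
rewrite leNgt; apply/negP => gt1.
have If : \int[lambda]_x f x < 0 by rewrite ef; lra.
have : {ae lambda, forall x, f x = 0}.
  apply: ae_eq0_of_Rintegral_le0 => //; last exact: ltW.
  apply: filterS2 (density_gt0 Tt) (density_gt0 Te) => x ? ?.
  by have [] := fP x.
have /measurable_EFinP mf := measurable_int _ fi.
move=> /(ae_eq_Rintegral mf (measurable_cst (0 : R))).
by rewrite Rintegral_cst// mul0r => e0; rewrite e0 ltxx in If.
Qed.

Lemma M_center theta eta :
  M p P alpha theta (P eta) eta =
  (alpha * (1 - alpha))^-1 * \int[P eta]_x r theta eta x.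
Proof.
have /andP[a0 a1] := alpha01; rewrite /M -mulrDl; congr (_ * _).
by field; apply/andP; split; rewrite ?gt_eqF//; lra.
Qed.

Lemma ratio_pow_diag theta : Theta theta ->
  (P theta).-integrable setT (EFin \o r theta theta) ->
  \int[P theta]_x r theta theta x = 1.
Proof.
move=> Tt ri; have [pti pt1] := model_density_probability Tt.
have rip := model_integrable_density Tt ri.
rewrite model_Rintegral_density// -pt1; apply: ae_eq_Rintegral.
- by have /measurable_EFinP := measurable_int _ rip.
- exact: model_measurable Hmodel _ Tt.
- apply: filterS (density_gt0 Tt) => x ptx.
  by rewrite ratio_powE// subrr mulr0 expR0 mul1r.
Qed.

(** The gap function, [alpha (1 - alpha)] times the integrand of [M] minus
    [p_theta], is the difference of the arithmetic and the geometric means of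
    [p_eta] and [p_theta], with weights [alpha] and [1 - alpha], multiplied by
    [(p_theta / p_eta)^alpha]; this factor turns the geometric mean into
    [p_theta]. *)
Lemma M_identify theta eta : Theta theta -> Theta eta ->
  (P theta).-integrable setT (EFin \o r theta eta) ->
  (P eta).-integrable setT (EFin \o r theta eta) ->
  M p P alpha theta (P theta) eta <= (alpha * (1 - alpha))^-1 ->
  eta = theta.
Proof.
move=> Tt Te rit rie leM; have /andP[a0 a1] := alpha01.
have [pti pt1] := model_density_probability Tt.
have ript := model_integrable_density Tt rit.
have ripe := model_integrable_density Te rie.
have ati := integrable_mull (1 - alpha) ript.
have aei := integrable_mull alpha ripe.
pose k x := alpha * (r theta eta x * p eta x)
  + (1 - alpha) * (r theta eta x * p theta x).
have ki : lambda.-integrable setT (EFin \o k) by exact: integrable_addr.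
have ek : \int[lambda]_x k x
    = alpha * (1 - alpha) * M p P alpha theta (P theta) eta.
  rewrite /k RintegralD// !RintegralZl// -!model_Rintegral_density// /M.
  by field; apply/andP; split; rewrite ?gt_eqF//; lra.
have fi : lambda.-integrable setT (EFin \o (fun x => k x - p theta x)).
  exact: integrable_subr.
apply: (density_identify Tt Te fi).
  have aa : 0 < alpha * (1 - alpha) by rewrite mulr_gt0// subr_gt0.
  rewrite RintegralB// ek pt1 subr_le0.
  by rewrite mulrC -ler_pdivlMr// div1r.
move=> x ptx pex.
have := expR_weighted_le (ln (p eta x)) (ln (p theta x)) alpha01.
have := @expR_weighted_eq _ _ (ln (p eta x)) (ln (p theta x)) alpha01.
rewrite !expR_ln_density// => eq_w le_w.
have rpos : 0 < r theta eta x by rewrite ratio_powE// expR_gt0.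
have rE : p theta x = r theta eta x *
    expR (alpha * ln (p eta x) + (1 - alpha) * ln (p theta x)).
  rewrite ratio_powE// -expRD -[LHS]expR_ln_density//.
  by congr expR; ring.
have -> : k x - p theta x = r theta eta x *
    (alpha * p eta x + (1 - alpha) * p theta x
     - expR (alpha * ln (p eta x) + (1 - alpha) * ln (p theta x))).
  rewrite mulrBr -rE /k; ring.
split; first by rewrite mulr_ge0 ?subr_ge0 // (ltW rpos).
move=> /eqP; rewrite mulf_eq0 gt_eqF//= subr_eq0 => /eqP e0.
by apply: (@ln_inj R) => //; exact: eq_w.
Qed.

End Identification.

(** * Extrema and curves of zeros *)

Section Calculus.
Context {R : realType}.

Lemma derive_local_max (V : normedModType R) (f : V -> R) (a v : V) :
  differentiable f a -> (\forall y \near a, f y <= f a) -> 'D_v f a = 0.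
Proof.
move=> /(@diff_derivable _ _ _ _ _ v) fd fmax.
have hmax : \forall h \near (0 : R), f (h *: v + a) <= f a.
  have : (h *: v + a) @[h --> (0 : R)] --> a.
    rewrite -[X in _ --> X](add0r a) -[X in X + _](scale0r v).
    by apply: cvgD; [apply: cvgZr_tmp; exact: cvg_id | exact: cvg_cst].
  by move=> /(_ _ fmax).
pose q h := h^-1 *: (f (h *: v + a) - f a).
have qr : q h @[h --> 0^'+] --> 'D_v f a by exact: cvg_dnbhs_at_right fd.
have ql : q h @[h --> 0^'-] --> 'D_v f a by exact: cvg_dnbhs_at_left fd.
apply/eqP; rewrite eq_le; apply/andP; split.
  rewrite -(cvg_lim _ qr)//; apply: limr_le; first exact: cvgP qr.
  near=> h; apply: mulr_ge0_le0.
    by rewrite invr_ge0; near: h; exact: nbhs_right_ge.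
  by rewrite subr_le0; near: h; apply: cvg_within; exact: hmax.
rewrite -(cvg_lim _ ql)//; apply: limr_ge; first exact: cvgP ql.
near=> h; apply: mulr_le0.
  by rewrite invr_le0; near: h; exact: nbhs_left_le.
by rewrite subr_le0; near: h; apply: cvg_within; exact: hmax.
Unshelve. all: by end_near. Qed.

Lemma derive_local_min (V : normedModType R) (f : V -> R) (a v : V) :
  differentiable f a -> (\forall y \near a, f a <= f y) -> 'D_v f a = 0.
Proof.
move=> fd fmin; apply/eqP; rewrite -oppr_eq0 -deriveN;
  last exact: diff_derivable.
apply/eqP; apply: derive_local_max; first exact: differentiableN.
by apply: filterS fmin => y; rewrite lerN2.
Qed.

Lemma cvg_curve (V : normedModType R) (y : R -> V) (y0 k : V) :
  (e^-1 *: (y e - y0)) @[e --> 0^'+] --> k -> y e @[e --> 0^'+] --> y0.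
Proof.
move=> yk.
have : (y0 + e *: (e^-1 *: (y e - y0))) @[e --> 0^'+] --> y0.
  rewrite -[X in _ --> X]addr0 -[X in _ + X](scale0r k).
  apply: cvgD; first exact: cvg_cst.
  by apply: cvgZ => //; apply: cvg_at_right_filter; exact: cvg_id.
apply: cvg_trans; apply: near_eq_cvg; near=> e.
have e0 : e != 0 by apply: lt0r_neq0; near: e; exact: nbhs_right_gt.
by rewrite scalerA divff// scale1r addrC subrK.
Unshelve. all: by end_near. Qed.

(** The chain rule for a curve that has only a one-sided derivative [k], and
    only at its end point. *)
Lemma cvg_diff_curve (V W : normedModType R) (f : V -> W) (y : R -> V)
    (y0 k : V) :
  differentiable f y0 -> (e^-1 *: (y e - y0)) @[e --> 0^'+] --> k ->
  (e^-1 *: (f (y e) - f y0)) @[e --> 0^'+] --> 'd f y0 k.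
Proof.
move=> fd yk; have yy0 := cvg_curve yk.
have hc : (y e - y0) @[e --> 0^'+] --> (0 : V).
  by rewrite -(subrr y0); apply: cvgB => //; exact: cvg_cst.
have [dfc dfo] := (diff_locallyxP _ _).1 fd.
have := dfo; set o := 'o _ => {}dfo.
have : (e^-1 *: o (y e - y0)) @[e --> 0^'+] --> (0 : W).
  apply/cvgr0Pnorm_le => eps eps0.
  have k0 : 0 < `|k| + 1 by rewrite ltr_wpDl.
  have : 0 < eps / (`|k| + 1) by rewrite divr_gt0.
  move=> /(littleoP [littleo of o]) /hc ho.
  have nk : `|e^-1 *: (y e - y0)| @[e --> 0^'+] --> `|k| by exact: cvg_norm.
  near=> e.
  have oe : `|o (y e - y0)| <= eps / (`|k| + 1) * `|y e - y0| by near: e.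
  rewrite normrZ; apply: le_trans (ler_wpM2l (normr_ge0 _) oe) _.
  rewrite mulrCA -normrZ.
  apply: (@le_trans _ _ (eps / (`|k| + 1) * (`|k| + 1))); last first.
    by rewrite divfK// gt_eqF.
  rewrite ler_pM2l ?divr_gt0//; near: e; apply: (cvgr_le _ nk).
  by rewrite ltrDl.
have : 'd f y0 (e^-1 *: (y e - y0)) @[e --> 0^'+] --> 'd f y0 k.
  by apply: cvg_comp yk _; exact: dfc.
move=> /cvgD /[apply]; rewrite addr0; apply: cvg_trans.
apply: near_eq_cvg; near=> e.
have -> : f (y e) = f y0 + 'd f y0 (y e - y0) + o (y e - y0).
  by rewrite -dfo subrK.
rewrite !fctE linearZ /= -scalerDr; congr (_ *: _).
by rewrite -(addrA (f y0)) [f y0 + _]addrC addrK.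
Unshelve. all: by end_near. Qed.

(** Divide the equation by [e] and let [e] tend to [0]: since [F0 y0 = 0], the
    first term becomes a difference quotient of [F0] along the curve. *)
Lemma zero_curve_derive (V : normedModType R) (F0 F1 : V -> R) (y : R -> V)
    (y0 k : V) :
  differentiable F0 y0 -> {for y0, continuous F1} -> F0 y0 = 0 ->
  (e^-1 *: (y e - y0)) @[e --> 0^'+] --> k ->
  (\forall e \near 0^'+, (1 - e) * F0 (y e) + e * F1 (y e) = 0) ->
  'D_k F0 y0 + F1 y0 = 0.
Proof.
move=> F0d F1c F00 yk zero.
have yy0 := cvg_curve yk.
have id0 : e @[e --> (0 : R)^'+] --> (0 : R).
  by apply: cvg_at_right_filter; exact: cvg_id.
have : ((1 - e) * (e^-1 * (F0 (y e) - F0 y0)) + F1 (y e)) @[e --> 0^'+]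
    --> (1 - 0) * 'D_k F0 y0 + F1 y0.
  apply: cvgD.
    apply: cvgM; first by apply: cvgB => //; exact: cvg_cst.
    by rewrite deriveE//; exact: cvg_diff_curve.
  exact: cvg_comp yy0 F1c.
rewrite subr0 mul1r => lim_e.
have : (0 : R) @[e --> (0 : R)^'+] --> 'D_k F0 y0 + F1 y0.
  apply: cvg_trans lim_e; apply: near_eq_cvg; near=> e.
  have e0 : e != 0 by apply: lt0r_neq0; near: e; exact: nbhs_right_gt.
  have : e^-1 * ((1 - e) * F0 (y e) + e * F1 (y e)) = 0.
    by rewrite (near zero e _) ?mulr0//.
  by rewrite F00 subr0 mulrDr mulKf// mulrCA.
by move=> /(cvg_lim (@Rhausdorff R)) <-; rewrite lim_cst.
Unshelve. all: by end_near. Qed.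

End Calculus.

(** * First-order conditions and the envelope principle *)

Section FirstOrder.
Context {R : realType}.

Lemma derive_affine (V : normedModType R) (a b : R) (f g : V -> R) (y v : V) :
  derivable f y v -> derivable g y v ->
  'D_v (fun z => a * f z + b * g z) y = a * 'D_v f y + b * 'D_v g y.
Proof.
move=> fd gd.
rewrite (_ : (fun z => _) = a *: f + b *: g)//.
rewrite deriveD; [|exact: derivableZ..].
by rewrite !deriveZ.
Qed.

Lemma differentiable_affine (V : normedModType R) (a b : R) (f g : V -> R)
    (y : V) : differentiable f y -> differentiable g y ->
  differentiable (fun z => a * f z + b * g z) y.
Proof.
move=> fd gd.
by apply: (@differentiableD _ _ _ (a *: f) (b *: g)); exact: differentiableZ.
Qed.

Lemma critical_curve_derive (V : normedModType R) (U : set V) (L0 L1 : V -> R)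
    (y : R -> V) (y0 k v : V) :
  twice_differentiable U L0 -> twice_differentiable U L1 -> U y0 ->
  'D_v L0 y0 = 0 -> (e^-1 *: (y e - y0)) @[e --> 0^'+] --> k ->
  (\forall e \near 0^'+, U (y e) /\
     'D_v (fun z => (1 - e) * L0 z + e * L1 z) (y e) = 0) ->
  'D_k ('D_v L0) y0 + 'D_v L1 y0 = 0.
Proof.
move=> [L0d L0dd] [L1d L1dd] Uy0 L00 yk crit.
apply: (@zero_curve_derive _ _ ('D_v L0) ('D_v L1) y) L00 yk _.
- exact: L0dd.
- exact/differentiable_continuous/L1dd.
- apply: filterS crit => e [Uy <-].
  by rewrite derive_affine//; apply: diff_derivable; [exact: L0d|exact: L1d].
Qed.

(** At a point where [m] is stationary in its second argument, the derivative
    of [t |-> m (t, g t)] does not see the variation of [g]. *)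
Lemma envelope (V W : normedModType R) (m : V * W -> R) (g : V -> W)
    (t0 v : V) :
  differentiable m (t0, g t0) -> differentiable g t0 ->
  (forall w, 'D_(0, w) m (t0, g t0) = 0) ->
  (\forall t \near t0, m (t, g t) <= m (t0, g t0)) ->
  'D_(v, 0) m (t0, g t0) = 0.
Proof.
move=> md gd mw mmax.
have pd : differentiable (fun t => (t, g t)) t0 by exact: differentiable_pair.
have cd : differentiable (m \o (fun t => (t, g t))) t0.
  exact: differentiable_comp.
have := derive_local_max v cd mmax.
rewrite deriveE// diff_comp//= diff_pair//= diff_val.
have -> : (v, 'd g t0 v) = (v, 0) + (0, 'd g t0 v).
  by congr (_, _); rewrite /= ?addr0 ?add0r.
by rewrite linearD /= -!deriveE// mw addr0.
Qed.

Lemma derive_prodr (V W : normedModType R) (m : V * W -> R) (t : V) (s w : W) :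
  'D_(0, w) m (t, s) = 'D_w (fun z => m (t, z)) s.
Proof.
rewrite /derive.
have -> : (fun h : R => h^-1 *: ((m \o shift (t, s)) (h *: (0, w)) - m (t, s)))
    = (fun h => h^-1 *: (((fun z => m (t, z)) \o shift s) (h *: w) - m (t, s))).
  apply/funext => h /=.
  have -> : h *: (0, w) + (t, s) = (h *: 0 + t, h *: w + s) by [].
  by rewrite scaler0 add0r.
by [].
Qed.

Lemma derive_prodl (V W : normedModType R) (m : V * W -> R) (t v : V) (s : W) :
  'D_(v, 0) m (t, s) = 'D_v (fun z => m (z, s)) t.
Proof.
rewrite /derive.
have -> : (fun h : R => h^-1 *: ((m \o shift (t, s)) (h *: (v, 0)) - m (t, s)))
    = (fun h => h^-1 *: (((fun z => m (z, s)) \o shift t) (h *: v) - m (t, s))).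
  apply/funext => h /=.
  have -> : h *: (v, 0) + (t, s) = (h *: v + t, h *: 0 + s) by [].
  by rewrite scaler0 add0r.
by [].
Qed.

End FirstOrder.

(** * Directional derivatives of log-densities *)

Section Directional.
Context {R : realType}.

Lemma derive_lineE (V : normedModType R) (f : V -> R) (y v : V) :
  (fun h : R => h^-1 *: ((f \o shift y) (h *: v) - f y)) =
  (fun h : R => h^-1 *:
     (((fun k : R => f (k *: v + y)) \o shift 0) (h *: 1) - f (0 *: v + y))).
Proof.
by apply/funext => h /=; rewrite addr0 scale0r add0r [h%:A]mulr1.
Qed.

Lemma is_derive_line (V : normedModType R) (f : V -> R) (y v : V) (df : R) :
  is_derive y v f df <-> is_derive (0 : R) 1 (fun h : R => f (h *: v + y)) df.
Proof.
split=> -[].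
  by rewrite /derivable /derive (derive_lineE f y v); exact: DeriveDef.
move=> fd fE.
by apply: DeriveDef; rewrite /derivable /derive (derive_lineE f y v).
Qed.

(** Restriction to the line through [y] in the direction [v] reduces this to
    the chain rule in one variable. *)
Lemma is_derive_chain (V : normedModType R) (f : V -> R) (phi : R -> R)
    (y v : V) (df dphi : R) :
  is_derive y v f df -> is_derive (f y) 1 phi dphi ->
  is_derive y v (phi \o f) (dphi * df).
Proof.
move=> /is_derive_line fd phid; apply/is_derive_line.
apply: (@is_derive1_comp _ phi (fun h : R => f (h *: v + y))).
by rewrite scale0r add0r.
Qed.

Lemma is_derive_fst (V W : normedModType R) (f : V -> R) (t u : V) (s w : W)
    (df : R) :
  is_derive t u f df -> is_derive (t, s) (u, w) (fun z => f z.1) df.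
Proof. by move=> /is_derive_line fd; apply/is_derive_line. Qed.

Lemma is_derive_snd (V W : normedModType R) (f : W -> R) (t u : V) (s w : W)
    (df : R) :
  is_derive s w f df -> is_derive (t, s) (u, w) (fun z => f z.2) df.
Proof. by move=> /is_derive_line fd; apply/is_derive_line. Qed.

Lemma near_eq_derive2 (V : normedModType R) (f g : V -> R) (y u v : V) :
  (\near y, f y = g y) -> 'D_u ('D_v f) y = 'D_u ('D_v g) y.
Proof.
move=> /near_join fg; apply: near_eq_derive.
by apply: filterS fg => z; exact: near_eq_derive.
Qed.

End Directional.

(** This is [q z.1 ^ a * q z.2 ^ b] where [q] is positive, written so that its
    logarithmic derivatives are sums. *)
Definition exp_log {R : realType} {V : normedModType R} (q : V -> R) (a b : R)
  (z : V * V) : R := expR (a * ln (q z.1) + b * ln (q z.2)).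

Section LogDensity.
Context {R : realType} {V : normedModType R} {U : set V} {q : V -> R} {y0 : V}.
Hypothesis U_open : open U.
Hypothesis q_smooth : twice_differentiable U q.
Hypothesis Uy0 : U y0.
Hypothesis q_gt0 : 0 < q y0.

Local Notation l := (fun y => ln (q y)).

Lemma nbhs_positive : \forall y \near y0, U y /\ 0 < q y.
Proof.
near=> y; split; near: y; first exact: open_nbhs_nbhs.
have /differentiable_continuous qc : differentiable q y0 by exact: q_smooth.1.
exact: (cvgr_gt _ qc).
Unshelve. all: by end_near. Qed.

Lemma is_derive_log y v : U y -> 0 < q y ->
  is_derive y v l ((q y)^-1 * 'D_v q y).
Proof.
move=> Uy qy; apply: (@is_derive_chain _ _ q (@ln R)); last first.
  exact: is_derive1_ln.
by apply: derivableP; apply: diff_derivable; exact: q_smooth.1.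
Qed.

Lemma derive_log v : 'D_v l y0 * q y0 = 'D_v q y0.
Proof.
have [_ ->] := is_derive_log v Uy0 q_gt0.
by rewrite mulrAC mulVf ?mul1r// gt_eqF.
Qed.

Lemma is_derive2_log u v : is_derive y0 u ('D_v l)
  ((q y0)^-1 * 'D_u ('D_v q) y0 - 'D_u l y0 * 'D_v l y0).
Proof.
apply: (@near_eq_is_derive _ _ _ (fun y => (q y)^-1 * 'D_v q y)).
  apply: filterS nbhs_positive => y [Uy qy].
  by have [_ ->] := is_derive_log v Uy qy.
have qd : is_derive y0 u q ('D_u q y0).
  by apply: derivableP; apply: diff_derivable; exact: q_smooth.1.
have vd : is_derive y0 u ('D_v q) ('D_u ('D_v q) y0).
  by apply: derivableP; apply: diff_derivable; exact: q_smooth.2.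
have qn0 : q y0 != 0 by rewrite gt_eqF.
have Vd : is_derive y0 u (fun y => (q y)^-1) (- (q y0) ^- 2 *: 'D_u q y0).
  have [qd' qE] := qd.
  by apply: DeriveDef; [exact: derivableV | rewrite deriveV].
have Md : is_derive y0 u ((fun y => (q y)^-1) * 'D_v q)
    ((q y0)^-1 *: 'D_u ('D_v q) y0 + 'D_v q y0 *: (- (q y0) ^- 2 *: 'D_u q y0)).
  exact: is_deriveM Vd vd.
apply: (is_derive_eq Md).
rewrite -!derive_log /GRing.scale /=; field.
exact: qn0.
Qed.

Lemma derive2_log u v : 'D_u ('D_v l) y0 * q y0 =
  'D_u ('D_v q) y0 - 'D_u l y0 * 'D_v l y0 * q y0.
Proof.
have [_ ->] := is_derive2_log u v; rewrite mulrBl; congr (_ - _).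
by rewrite mulrAC mulVf ?mul1r// gt_eqF.
Qed.

Lemma is_derive_exp_log a b t s u w :
  U t -> 0 < q t -> U s -> 0 < q s ->
  is_derive (t, s) (u, w) (exp_log q a b)
    (exp_log q a b (t, s) * (a * 'D_u l t + b * 'D_w l s)).
Proof.
move=> Ut qt Us qs.
apply: (@is_derive_chain _ _ (fun z => a * ln (q z.1) + b * ln (q z.2))).
have h1 : is_derive (t, s) (u, w) (fun z : V * V => ln (q z.1)) ('D_u l t).
  have [lt _] := is_derive_log u Ut qt.
  exact: (@is_derive_fst _ _ _ l _ _ _ _ _ (derivableP lt)).
have h2 : is_derive (t, s) (u, w) (fun z : V * V => ln (q z.2)) ('D_w l s).
  have [ls _] := is_derive_log w Us qs.
  exact: (@is_derive_snd _ _ _ l _ _ _ _ _ (derivableP ls)).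
exact: (is_deriveD (is_deriveZ a h1) (is_deriveZ b h2)).
Qed.

Lemma derive_exp_log a b v : 'D_(v, 0) (exp_log q a b) (y0, y0) =
  a * 'D_v l y0 * exp_log q a b (y0, y0).
Proof.
have [_ ->] := is_derive_exp_log a b v 0 Uy0 q_gt0 Uy0 q_gt0.
by rewrite derive0; ring.
Qed.

Lemma nbhs_positive_pair : \forall z \near (y0, y0),
  [/\ U z.1, 0 < q z.1, U z.2 & 0 < q z.2].
Proof.
exists ([set y | U y /\ 0 < q y], [set y | U y /\ 0 < q y]) => /=.
  by split; exact: nbhs_positive.
by move=> z [[? ?] [? ?]].
Qed.

Lemma derive2_exp_log a b u w v :
  'D_(u, w) ('D_(v, 0) (exp_log q a b)) (y0, y0) =
  a * exp_log q a b (y0, y0) * ('D_u ('D_v l) y0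
    + 'D_v l y0 * (a * 'D_u l y0 + b * 'D_w l y0)).
Proof.
rewrite (@near_eq_derive _ _ _ _
  (fun z => a *: ('D_v l z.1 * exp_log q a b z))); last first.
  apply: filterS nbhs_positive_pair => -[t s] [/= Ut qt Us qs].
  have [_ ->] := is_derive_exp_log a b v 0 Ut qt Us qs.
  by rewrite derive0 /GRing.scale /=; ring.
have h1 : is_derive (y0, y0) (u, w) (fun z : V * V => 'D_v l z.1)
    ('D_u ('D_v l) y0).
  have [lt _] := is_derive2_log u v.
  exact: (@is_derive_fst _ _ _ ('D_v l) _ _ _ _ _ (derivableP lt)).
have h2 := is_derive_exp_log a b u w Uy0 q_gt0 Uy0 q_gt0.
pose D1 := 'D_u ('D_v l) y0; pose D2 := exp_log q a b (y0, y0) *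
  (a * 'D_u l y0 + b * 'D_w l y0).
have Md : is_derive (y0, y0) (u, w)
    ((fun z : V * V => 'D_v l z.1) * exp_log q a b)
    ('D_v l y0 *: D2 + exp_log q a b (y0, y0) *: D1).
  exact: is_deriveM h1 h2.
have [_ ->] := is_deriveZ a Md.
rewrite /D1 /D2.
by rewrite /GRing.scale /=; ring.
Qed.

End LogDensity.

(** * Score and Fisher information *)

Lemma open_setX (S T : topologicalType) (A : set S) (B : set T) :
  open A -> open B -> open (A `*` B).
Proof.
rewrite !openE => Ao Bo [s t] [/= As Bt]; exists (A, B) => //=.
by split; [exact: Ao|exact: Bo].
Qed.

(** The two interchanges compose because the first one holds on the open set
    [U], hence near [y], and derivatives at [y] are local. *)
Lemma derive2_under_integral {disp : measure_display} {X : measurableType disp}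
    {R : realType} (mu : {measure set X -> \bar R}) (V : normedModType R)
    (U : set V) (F : V -> X -> R) (u v y : V) :
  open U -> twice_diff_under_integral mu U F -> U y ->
  [/\ mu.-integrable setT (EFin \o (fun x => 'D_u ('D_v (F ^~ x)) y)),
      derivable ('D_v (fun z => \int[mu]_x F z x)) y u &
      'D_u ('D_v (fun z => \int[mu]_x F z x)) y
        = \int[mu]_x 'D_u ('D_v (F ^~ x)) y].
Proof.
move=> Uo [F1 F2] Uy; have [_ Fi Fd FE] := F2 v u y Uy.
have near_int : \near y,
    \int[mu]_x 'D_v (F ^~ x) y = 'D_v (fun z => \int[mu]_x F z x) y.
  have nU : nbhs y U by exact: open_nbhs_nbhs.
  apply: filterS nU => z Uz; have [_ _ _ E] := F1 v z Uz.
  exact: esym E.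
split.
- exact: Fi.
- exact: near_eq_derivable near_int Fd.
- by rewrite -FE; apply/esym; exact: near_eq_derive near_int.
Qed.

Section Score.
Context {disp : measure_display} {X : measurableType disp} {R : realType}.
Context {d : nat} {Theta : set 'cV[R]_d}.
Context {lambda : {sigma_finite_measure set X -> \bar R}}.
Context {p : 'cV[R]_d -> X -> R} {P : 'cV[R]_d -> probability X R}.
Context {P0 : probability X R}.
Hypothesis Hmodel : model Theta lambda p P P0.
Hypothesis Hsmooth : smooth_densities Theta lambda p P.
Implicit Types (theta eta h u v : 'cV[R]_d) (x : X) (i j : 'I_d).

Local Notation logp x := (fun t => ln (p t x)).
Local Notation unit_vec i := (delta_mx i 0 : 'cV[R]_d).

Lemma scoreE theta x i : score p theta x i 0 = 'D_(unit_vec i) (logp x) theta.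
Proof. by rewrite mxE. Qed.

(** Linearity is inherited from the differential of the density, as only the
    densities are assumed to be differentiable. *)
Lemma score_direction theta x h : Theta theta -> 0 < p theta x ->
  'D_h (logp x) theta = \sum_j h j 0 * score p theta x j 0.
Proof.
move=> Tt px; have psm := density_twice_diff Hsmooth x.
have pn0 : p theta x != 0 by rewrite gt_eqF.
have dlog v := derive_log psm Tt px v.
apply: (mulIf pn0); rewrite dlog big_distrl /=.
under eq_bigr do rewrite -mulrA scoreE dlog.
rewrite deriveE; last exact: psm.1.
rewrite [in LHS](matrix_sum_delta h) linear_sum; apply: eq_bigr => j _.
by rewrite big_ord1 linearZ /= -deriveE//; exact: psm.1.
Qed.

(** The total mass is [1] for all parameters of the open set. *)
Lemma Rintegral_derive_density theta v : Theta theta ->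
  lambda.-integrable setT (EFin \o (fun x => 'D_v (p ^~ x) theta)) /\
  \int[lambda]_x 'D_v (p ^~ x) theta = 0.
Proof.
move=> Tt; have [_ vi _ <-] := (density_interchange Hsmooth).1 v theta Tt.
split=> //; rewrite (near_eq_derive v (g := cst (1 : R))) ?derive_cst//.
have : nbhs theta Theta.
  by apply: open_nbhs_nbhs; split=> //; exact: model_open Hmodel.
by apply: filterS => t Tt'; have [] := model_density_probability Hmodel Tt'.
Qed.

Lemma Rintegral_derive2_density theta u v : Theta theta ->
  lambda.-integrable setT (EFin \o (fun x => 'D_u ('D_v (p ^~ x)) theta)) /\
  \int[lambda]_x 'D_u ('D_v (p ^~ x)) theta = 0.
Proof.
move=> Tt.
have [ui _ <-] := derive2_under_integral u v (model_open Hmodel)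
  (density_interchange Hsmooth) Tt.
split=> //; rewrite (near_eq_derive2 _ _ (g := cst (1 : R))); last first.
  have : nbhs theta Theta.
    by apply: open_nbhs_nbhs; split=> //; exact: model_open Hmodel.
  by apply: filterS => t Tt'; have [] := model_density_probability Hmodel Tt'.
rewrite (_ : 'D_v (cst (1 : R)) = cst 0) ?derive_cst//.
by apply/funext => t; rewrite derive_cst.
Qed.

(** A representative of [(D_h ln p) (D_i ln p)] that is integrable as it
    stands: where the density vanishes, the directional derivatives of its
    logarithm need not be linear in the direction. *)
Definition information theta h i x : R :=
  \sum_j h j 0 * (score p theta x i 0 * score p theta x j 0).

Lemma information_score theta h i x : Theta theta -> 0 < p theta x ->
  'D_h (logp x) theta * score p theta x i 0 = information theta h i x.
Proof.
move=> Tt px; rewrite score_direction// /information big_distrl /=.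
by apply: eq_bigr => j _; rewrite -mulrA [_ * score p theta x i 0]mulrC.
Qed.

Lemma Rintegral_information theta h i : Theta theta ->
  lambda.-integrable setT
    (EFin \o (fun x => information theta h i x * p theta x)) /\
  \int[lambda]_x (information theta h i x * p theta x)
    = (fisher p P theta *m h) i 0.
Proof.
move=> Tt; have ij j := fisher_integrable Hsmooth i j Tt.
have infi : (P theta).-integrable setT (EFin \o information theta h i).
  exact: integrable_lincomb.
split; first exact: (model_integrable_density Hmodel Tt infi).
rewrite -(model_Rintegral_density Hmodel)// Rintegral_lincomb// mxE.
by apply: eq_bigr => j _; rewrite mxE mulrC.
Qed.

(** The second derivative of the density integrates to [0], whatever its
    coefficient [c]; it is [1] for maximum likelihood and [1 / (1 - alpha)]
    for the superdivergence. *)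
Lemma Rintegral_bartlett theta h i (c : R) (f : X -> R) : Theta theta ->
  lambda.-integrable setT (EFin \o f) ->
  (forall x, 0 < p theta x -> f x =
     c * 'D_h ('D_(unit_vec i) (p ^~ x)) theta
     - 'D_h (logp x) theta * score p theta x i 0 * p theta x) ->
  \int[lambda]_x f x = - (fisher p P theta *m h) i 0.
Proof.
move=> Tt fi fE.
have [d2i d20] := Rintegral_derive2_density h (unit_vec i) Tt.
have [infi infE] := Rintegral_information h i Tt.
have cd2i := integrable_mull c d2i.
pose g x := c * 'D_h ('D_(unit_vec i) (p ^~ x)) theta
  - information theta h i x * p theta x.
have gi : lambda.-integrable setT (EFin \o g) by exact: integrable_subr.
rewrite (@ae_eq_Rintegral _ _ _ lambda f g).
- by rewrite /g RintegralB// RintegralZl// d20 infE mulr0 sub0r.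
- by have /measurable_EFinP := measurable_int _ fi.
- by have /measurable_EFinP := measurable_int _ gi.
- apply: filterS (density_gt0 Hmodel Tt) => x px.
  by rewrite fE// information_score.
Qed.

End Score.

(** * Influence functions *)

Section Influence.
Context {disp : measure_display} {X : measurableType disp} {R : realType}.
Context {d : nat} {Theta : set 'cV[R]_d}.
Context {lambda : {sigma_finite_measure set X -> \bar R}}.
Context {p : 'cV[R]_d -> X -> R} {P : 'cV[R]_d -> probability X R}.
Context {P0 : probability X R}.
Hypothesis Hmodel : model Theta lambda p P P0.
Hypothesis Hsmooth : smooth_densities Theta lambda p P.

Variables (theta : 'cV[R]_d) (x : X).
Hypothesis Ttheta : Theta theta.
Hypothesis px : 0 < p theta x.

Local Notation unit_vec i := (delta_mx i 0 : 'cV[R]_d).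
Local Notation mix e := (mixture (P theta) e x).

Lemma calQ_mix_model : calQ_mix Theta P P0 (P theta).
Proof. by left; left; exists theta. Qed.

Lemma calQ_mix_mixture e : 0 <= e <= 1 -> calQ_mix Theta P P0 (mix e).
Proof.
by move=> e01; right; exists (P theta), e, x; split=> //; left; exists theta.
Qed.

(** Using the mixture at [e = 1] instead of the value at [x] keeps both
    summands among the criteria whose smoothness in the parameter is assumed.
    *)
Lemma Rintegral_mixture_affine e (f : X -> R) : 0 <= e <= 1 ->
  (P theta).-integrable setT (EFin \o f) ->
  \int[mix e]_y f y = (1 - e) * \int[P theta]_y f y + e * \int[mix 1]_y f y.
Proof.
move=> e01 fi; rewrite !Rintegral_mixture// ?lexx ?ler01//.
by rewrite subrr mul0r add0r mul1r.
Qed.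

Lemma near_theta : \forall t \near theta, Theta t.
Proof. by apply: open_nbhs_nbhs; split=> //; exact: model_open Hmodel. Qed.

Lemma near_unit_right : \forall e \near (0 : R)^'+, 0 <= e <= 1.
Proof.
near=> e; apply/andP; split; near: e; first exact: nbhs_right_ge.
exact: nbhs_right_le.
Unshelve. all: by end_near. Qed.

(** The common end of both proofs: [h] is the influence function, and [k], the
    derivative of the curve of solutions, is [h] itself or a pair that begins
    with [h]. *)
Lemma fisher_equation (V : normedModType R) (U : set V) (L0 L1 : V -> R)
    (y : R -> V) (y0 k v : V) (h : 'cV[R]_d) i :
  twice_differentiable U L0 -> twice_differentiable U L1 -> U y0 ->
  'D_v L0 y0 = 0 -> (e^-1 *: (y e - y0)) @[e --> 0^'+] --> k ->
  (\forall e \near 0^'+, U (y e) /\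
     'D_v (fun z => (1 - e) * L0 z + e * L1 z) (y e) = 0) ->
  'D_k ('D_v L0) y0 = - (fisher p P theta *m h) i 0 ->
  'D_v L1 y0 = score p theta x i 0 ->
  (fisher p P theta *m h) i 0 = score p theta x i 0.
Proof.
move=> L0d L1d Uy0 L00 yk crit hess grad.
have := critical_curve_derive L0d L1d Uy0 L00 yk crit.
by rewrite hess grad addrC => /subr0_eq.
Qed.

Section MaximumLikelihood.
Variable T0 : probability X R -> 'cV[R]_d.
Hypothesis Hmle : mle_assumptions Theta p P P0 T0.

Local Notation L Q := (fun t => \int[Q]_y ln (p t y)).

Lemma mle_consistent : T0 (P theta) = theta.
Proof.
have QP := calQ_mix_model.
have [Tm Tmax] := mle_argmax Hmle QP.
apply: (likelihood_identify Hmodel) => //.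
- exact: mle_integrable Hmle _ _ Ttheta QP.
- exact: mle_integrable Hmle _ _ Tm QP.
- exact: Tmax.
Qed.

Lemma mle_hessian h i :
  'D_h ('D_(unit_vec i) (L (P theta))) theta = - (fisher p P theta *m h) i 0.
Proof.
have [fi _ ->] := derive2_under_integral h (unit_vec i) (model_open Hmodel)
  (mle_interchange Hmle Ttheta) Ttheta.
rewrite (model_Rintegral_density Hmodel)//.
apply: (Rintegral_bartlett Hmodel Hsmooth (c := 1)) => //.
  exact: (model_integrable_density Hmodel Ttheta fi).
move=> y py; rewrite mul1r scoreE.
apply: (derive2_log (model_open Hmodel)) => //.
exact: density_twice_diff Hsmooth y.
Qed.

Lemma mle_critical e i : 0 <= e <= 1 ->
  'D_(unit_vec i) (fun t => (1 - e) * L (P theta) t + e * L (mix 1) t)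
    (T0 (mix e)) = 0.
Proof.
move=> e01; have [Tm Tmax] := mle_argmax Hmle (calQ_mix_mixture e01).
have one01 : 0 <= (1 : R) <= 1 by rewrite lexx ler01.
have [D0 _] := mle_twice_diff Hmle calQ_mix_model.
have [D1 _] := mle_twice_diff Hmle (calQ_mix_mixture one01).
have mixE t : Theta t ->
    (1 - e) * L (P theta) t + e * L (mix 1) t = L (mix e) t.
  move=> Tt; rewrite -Rintegral_mixture_affine//.
  exact: mle_integrable Hmle _ _ Tt calQ_mix_model.
apply: derive_local_max.
  by apply: differentiable_affine; [exact: D0|exact: D1].
have : nbhs (T0 (mix e)) Theta.
  by apply: open_nbhs_nbhs; split=> //; exact: model_open Hmodel.
by apply: filterS => t Tt; rewrite !mixE//; exact: Tmax.
Qed.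

Lemma mle_score i : 'D_(unit_vec i) (L (mix 1)) theta = score p theta x i 0.
Proof.
rewrite scoreE; apply: near_eq_derive; apply: filterS near_theta => t Tt.
rewrite Rintegral_mixture ?lexx ?ler01//.
  by rewrite subrr mul0r add0r mul1r.
exact: mle_integrable Hmle _ _ Tt calQ_mix_model.
Qed.

Lemma mle_fisher_equation :
  fisher p P theta *m IF T0 (P theta) x = score p theta x.
Proof.
apply/colP => i.
have one01 : 0 <= (1 : R) <= 1 by rewrite lexx ler01.
have D0 := mle_twice_diff Hmle calQ_mix_model.
have D1 := mle_twice_diff Hmle (calQ_mix_mixture one01).
have crit0 : 'D_(unit_vec i) (L (P theta)) theta = 0.
  apply: derive_local_max; first exact: D0.1.
  apply: filterS near_theta => t Tt.
  have [_] := mle_argmax Hmle calQ_mix_model.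
  by rewrite mle_consistent; apply.
apply: (@fisher_equation _ Theta (L (P theta)) (L (mix 1)) (fun e => T0 (mix e))
  theta (IF T0 (P theta) x) (unit_vec i)) => //.
- have : IF_quotient T0 (P theta) x e @[e --> 0^'+] --> IF T0 (P theta) x.
    exact: mle_IF_exists Hmle _ _ Ttheta px.
  by rewrite /IF_quotient mle_consistent.
- apply: filterS near_unit_right => e e01; split; last exact: mle_critical.
  by have [] := mle_argmax Hmle (calQ_mix_mixture e01).
- exact: mle_hessian.
- exact: mle_score.
Qed.

End MaximumLikelihood.

Section PowerSuperdivergence.
Variables (alpha : R) (Ttilde : 'cV[R]_d -> probability X R -> 'cV[R]_d).
Variable T : probability X R -> 'cV[R]_d.
Hypothesis alpha01 : 0 < alpha < 1.
Hypothesis Hpow : power_assumptions Theta lambda p P P0 alpha Ttilde T.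

Local Notation r := (ratio_pow p alpha).
Local Notation criterion Q := (fun z => M p P alpha z.1 Q z.2).
Local Notation Theta2 := (Theta `*` Theta).

Let one01 : 0 <= (1 : R) <= 1. Proof. by rewrite lexx ler01. Qed.

Lemma ratio_integrable t s : Theta t -> Theta s ->
  (P theta).-integrable setT (EFin \o r t s).
Proof.
by move=> Tt Ts; exact: power_integrable Hpow _ _ _ Tt Ts calQ_mix_model.
Qed.

Lemma ratio_integrable_model t s : Theta t -> Theta s ->
  (P s).-integrable setT (EFin \o r t s).
Proof.
by move=> Tt Ts; apply: (power_integrable Hpow) => //; left; left; exists s.
Qed.

Lemma M_mixture e t s : 0 <= e <= 1 -> Theta t -> Theta s ->
  M p P alpha t (mix e) s =
  (1 - e) * M p P alpha t (P theta) s + e * M p P alpha t (mix 1) s.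
Proof.
move=> e01 Tt Ts; have ri := ratio_integrable Tt Ts.
rewrite /M (Rintegral_mixture_affine e01 ri).
ring.
Qed.

Lemma M_diag : M p P alpha theta (P theta) theta = (alpha * (1 - alpha))^-1.
Proof.
rewrite M_center// (ratio_pow_diag Hmodel)// ?mulr1//.
exact: ratio_integrable.
Qed.

Lemma M_center_le t : Theta t ->
  M p P alpha t (P theta) theta <= (alpha * (1 - alpha))^-1.
Proof.
move=> Tt; have /andP[a0 a1] := alpha01; rewrite M_center//.
have ri := ratio_integrable Tt Ttheta.
have [le1 _] := ratio_pow_affinity Hmodel alpha01 Tt Ttheta ri.
by rewrite ler_piMr// invr_ge0 mulr_ge0 ?ltW// subr_gt0.
Qed.

(** Stated for laws [Q] with the criterion of [P_theta] because the minimizer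
    at the mixture with [e = 0] is also needed, and this mixture is equal to
    [P_theta] only extensionally. *)
Lemma inner_consistent Q : calQ_mix Theta P P0 Q ->
  (forall s, Theta s ->
    M p P alpha theta Q s = M p P alpha theta (P theta) s) ->
  Ttilde theta Q = theta.
Proof.
move=> QP QE; have [Tm Tmin] := power_argmin Hpow Ttheta QP.
apply: (M_identify Hmodel alpha01) => //.
- exact: ratio_integrable.
- exact: ratio_integrable_model.
- by rewrite -M_diag -(QE _ Tm) -(QE _ Ttheta); exact: Tmin.
Qed.

Lemma inner_consistent_model : Ttilde theta (P theta) = theta.
Proof. by apply: inner_consistent => //; exact: calQ_mix_model. Qed.

(** With [t = T P_theta], the chain [M (theta, theta) <= M (t, eta (t)) <= M
    (t, theta)] bounds the affinity of [t] and [theta] from below by its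
    maximal value [1]. *)
Lemma power_consistent : T (P theta) = theta.
Proof.
have /andP[a0 a1] := alpha01; have QP := calQ_mix_model.
have [Tm /(_ _ Ttheta)] := power_argmax Hpow QP.
rewrite inner_consistent_model M_diag => le1.
have [Ts /(_ _ Ttheta) le2] := power_argmin Hpow Tm QP.
have ri := ratio_integrable Tm Ttheta.
apply: (ratio_pow_affinity Hmodel alpha01 Tm Ttheta ri).2.
have aa : 0 < alpha * (1 - alpha) by rewrite mulr_gt0// subr_gt0.
by have := le_trans le1 le2; rewrite M_center// ler_pMr ?invr_gt0.
Qed.

Lemma criterion_diff Q : calQ_mix Theta P P0 Q ->
  twice_differentiable Theta2 (criterion Q).
Proof. exact: power_twice_diff Hpow Q. Qed.

(** Here [g] is the smooth version of the inner minimizer; near [t0] it takes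
    values in the open parameter set, so that inner and outer extrema are
    interior. *)
Lemma power_critical e v (g : 'cV[R]_d -> 'cV[R]_d) :
  0 <= e <= 1 -> let t0 := T (mix e) in
  differentiable g t0 ->
  (\forall t \near t0, g t = Ttilde t (mix e)) ->
  'D_(v, 0) (fun z => (1 - e) * criterion (P theta) z + e * criterion (mix 1) z)
    (t0, g t0) = 0.
Proof.
move=> e01 t0 gd near_g; have eQ := calQ_mix_mixture e01.
have [Tt0 Tmax] := power_argmax Hpow eQ.
have gt0 := nbhs_singleton near_g.
have [Tg0 Tmin] := power_argmin Hpow Tt0 eQ.
pose m := fun z => (1 - e) * criterion (P theta) z + e * criterion (mix 1) z.
have mE t s : Theta t -> Theta s -> m (t, s) = M p P alpha t (mix e) s.
  by move=> Tt Ts; rewrite /m /= -M_mixture.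
have md t s : Theta t -> Theta s -> differentiable m (t, s).
  move=> Tt Ts; apply: differentiable_affine.
  - by apply: (criterion_diff calQ_mix_model).1.
  - by apply: (criterion_diff (calQ_mix_mixture one01)).1.
have nbhs_Theta t : Theta t -> nbhs t Theta.
  by move=> Tt; apply: open_nbhs_nbhs; split=> //; exact: model_open Hmodel.
apply: (@envelope _ _ _ m g) => //.
- by apply: md => //; rewrite gt0.
- move=> w; rewrite derive_prodr gt0; apply: derive_local_min.
    apply: (@differentiable_comp _ _ _ _ (fun s => (t0, s)) m); last exact: md.
    exact: differentiable_pair.
  apply: filterS (nbhs_Theta _ Tg0) => s Ts.
  by rewrite (mE _ _ Tt0 Tg0) (mE _ _ Tt0 Ts); exact: Tmin.
- apply: filterS2 near_g (nbhs_Theta _ Tt0) => t gt Tt.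
  have [Tg _] := power_argmin Hpow Tt eQ.
  by rewrite gt gt0 (mE _ _ Tt Tg) (mE _ _ Tt0 Tg0); exact: Tmax.
Qed.

(** The inner minimizer at [T Q_e] is [g (T Q_e, e)] for the assumed smooth
    extension [g], so the curve of pairs inherits a one-sided derivative at [e
    = 0] from the existence of the influence function and the chain rule. *)
Lemma power_curve : exists k : 'cV[R]_d,
  (e^-1 *: ((T (mix e), Ttilde (T (mix e)) (mix e)) - (theta, theta)))
    @[e --> 0^'+] --> (IF T (P theta) x, k) /\
  (\forall e \near 0^'+, Theta2 (T (mix e), Ttilde (T (mix e)) (mix e)) /\
    forall v, 'D_(v, 0) (fun z =>
      (1 - e) * criterion (P theta) z + e * criterion (mix 1) z)
      (T (mix e), Ttilde (T (mix e)) (mix e)) = 0).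
Proof.
have [g near_g] := power_argmin_smooth Hpow Ttheta px.
have [gd g0] := nbhs_singleton near_g.
have zero01 : 0 <= (0 : R) <= 1 by rewrite lexx ler01.
have {}g0 : g (theta, 0) = theta.
  rewrite g0 ?lexx//; apply: inner_consistent; first exact: calQ_mix_mixture.
  by move=> s Ts; rewrite M_mixture// subr0 mul1r mul0r addr0.
have Tc : e^-1 *: (T (mix e) - theta) @[e --> 0^'+] --> IF T (P theta) x.
  have : IF_quotient T (P theta) x e @[e --> 0^'+] --> IF T (P theta) x.
    exact: power_IF_exists Hpow _ _ Ttheta px.
  by rewrite /IF_quotient power_consistent.
have Pc : e^-1 *: ((T (mix e), e) - (theta, 0)) @[e --> 0^'+]
    --> (IF T (P theta) x, 1 : R).
  apply: cvg_trans (cvg_pair Tc (cvg_cst (1 : R))).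
  apply: near_eq_cvg; near=> e.
  have e0 : e != 0 by apply: lt0r_neq0; near: e; exact: nbhs_right_gt.
  have -> : e^-1 *: ((T (mix e), e) - (theta, 0)) =
    (e^-1 *: (T (mix e) - theta), e^-1 * (e - 0)) by [].
  by rewrite subr0 mulVf.
have gc := cvg_diff_curve gd Pc.
have near_curve : \forall e \near 0^'+, \forall y \near (T (mix e), e),
    differentiable g y /\ (0 <= y.2 -> g y = Ttilde y.1 (mix y.2)).
  exact: (cvg_curve Pc (near_join near_g)).
have near_gE : \forall e \near 0^'+,
    [/\ 0 <= e <= 1, differentiable (fun t => g (t, e)) (T (mix e)) &
      \forall t \near T (mix e), g (t, e) = Ttilde t (mix e)].
  apply: filterS2 near_unit_right near_curve => e e01 near_e.
  have e0 : 0 <= e by case/andP: e01.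
  split=> //.
    apply: (@differentiable_comp _ _ _ _ (fun t => (t, e)) g).
      exact: differentiable_pair.
    exact: (nbhs_singleton near_e).1.
  have : (t, e) @[t --> T (mix e)] --> (T (mix e), e).
    have /differentiable_continuous :
        differentiable (fun t => (t, e)) (T (mix e)).
      exact: differentiable_pair.
    exact.
  move=> te; have near_te : \forall t \near T (mix e),
      differentiable g (t, e) /\ (0 <= e -> g (t, e) = Ttilde t (mix e)).
    exact: te near_e.
  by apply: filterS near_te => t [_ /(_ e0)].
exists ('d g (theta, 0) (IF T (P theta) x, 1)); split.
  apply: cvg_trans (cvg_pair Tc gc); apply: near_eq_cvg.
  apply: filterS near_gE => e [_ _ /nbhs_singleton <-].
  by rewrite g0.
apply: filterS near_gE => e [e01 gde near_ge].
have eQ := calQ_mix_mixture e01.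
have [Te _] := power_argmax Hpow eQ.
split.
  by split=> //=; have [] := power_argmin Hpow Te eQ.
move=> v; rewrite -(nbhs_singleton near_ge).
exact: (power_critical v e01 gde near_ge).
Unshelve. all: by end_near. Qed.

(** Writing the first integral with respect to [lambda] removes the parameter
    from the measure, so that it can be differentiated under the integral. *)
Lemma criterionE t s : Theta t -> Theta s ->
  M p P alpha t (P theta) s =
  (1 - alpha)^-1 * \int[lambda]_y (p s y * r t s y)
  + alpha^-1 * \int[P theta]_y r t s y.
Proof.
move=> Tt Ts; rewrite /M (model_Rintegral_density Hmodel Ts).
  by congr (_ * _ + _); apply: eq_Rintegral => y _; rewrite mulrC.
exact: ratio_integrable_model.
Qed.

Lemma Theta2_open : open Theta2.
Proof. by apply: open_setX; exact: model_open Hmodel. Qed.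

Lemma near_Theta2 : \forall z \near (theta, theta), Theta2 z.
Proof. by apply: open_nbhs_nbhs; split=> //; exact: Theta2_open. Qed.

Lemma exp_log_diag (q : 'cV[R]_d -> R) (a b : R) t : 0 < q t ->
  exp_log q a b (t, t) = expR ((a + b) * ln (q t)).
Proof. by move=> qt; rewrite /exp_log mulrDl. Qed.

Lemma near_ratio_exp_log y : 0 < p theta y ->
  \forall z \near (theta, theta),
    r z.1 z.2 y = exp_log (p ^~ y) alpha (- alpha) z /\
    p z.2 y * r z.1 z.2 y = exp_log (p ^~ y) alpha (1 - alpha) z.
Proof.
move=> py; have := nbhs_positive_pair (model_open Hmodel)
  (density_twice_diff Hsmooth y) Ttheta py.
apply: filterS => z [_ p1 _ p2]; rewrite ratio_powE//; split.
  by rewrite /exp_log; congr expR; ring.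
by rewrite -[X in X * _]lnK// -expRD /exp_log; congr expR; ring.
Qed.

Section PointwiseRatio.
Variable y : X.
Hypothesis py : 0 < p theta y.
Local Notation logp := (fun t => ln (p t y)).
Local Notation origin := (theta, theta).

Let psm := density_twice_diff Hsmooth y.

Lemma derive_ratio v :
  'D_(v, 0) (fun z => r z.1 z.2 y) origin = alpha * 'D_v logp theta.
Proof.
have E : \forall z \near origin,
    r z.1 z.2 y = exp_log (p ^~ y) alpha (- alpha) z.
  by apply: filterS (near_ratio_exp_log py) => z [].
rewrite (near_eq_derive _ E) (derive_exp_log psm Ttheta py).
by rewrite exp_log_diag// subrr mul0r expR0 mulr1.
Qed.

Lemma derive_density_ratio v :
  'D_(v, 0) (fun z => p z.2 y * r z.1 z.2 y) origin
  = alpha * 'D_v logp theta * p theta y.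
Proof.
have E : \forall z \near origin,
    p z.2 y * r z.1 z.2 y = exp_log (p ^~ y) alpha (1 - alpha) z.
  by apply: filterS (near_ratio_exp_log py) => z [].
rewrite (near_eq_derive _ E) (derive_exp_log psm Ttheta py).
by rewrite exp_log_diag// addrC subrK mul1r lnK.
Qed.

Lemma derive2_ratio u w v :
  'D_(u, w) ('D_(v, 0) (fun z => r z.1 z.2 y)) origin =
  alpha * ('D_u ('D_v logp) theta
    + 'D_v logp theta * (alpha * 'D_u logp theta - alpha * 'D_w logp theta)).
Proof.
have E : \forall z \near origin,
    r z.1 z.2 y = exp_log (p ^~ y) alpha (- alpha) z.
  by apply: filterS (near_ratio_exp_log py) => z [].
rewrite (near_eq_derive2 _ _ E).
rewrite (derive2_exp_log (model_open Hmodel) psm Ttheta py).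
by rewrite exp_log_diag// subrr mul0r expR0 mulr1 mulNr.
Qed.

Lemma derive2_density_ratio u w v :
  'D_(u, w) ('D_(v, 0) (fun z => p z.2 y * r z.1 z.2 y)) origin =
  alpha * p theta y * ('D_u ('D_v logp) theta + 'D_v logp theta *
    (alpha * 'D_u logp theta + (1 - alpha) * 'D_w logp theta)).
Proof.
have E : \forall z \near origin,
    p z.2 y * r z.1 z.2 y = exp_log (p ^~ y) alpha (1 - alpha) z.
  by apply: filterS (near_ratio_exp_log py) => z [].
rewrite (near_eq_derive2 _ _ E).
rewrite (derive2_exp_log (model_open Hmodel) psm Ttheta py).
by rewrite exp_log_diag// [alpha + _]addrC subrK mul1r lnK.
Qed.

(** The direction [w] of the inner parameter disappears: its contributions are
    [alpha p (D_w l) (D_v l)] from the first term and the opposite from the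
    second. *)
Lemma superdivergence_derive2 u w v :
  (1 - alpha)^-1 * 'D_(u, w) ('D_(v, 0) (fun z => p z.2 y * r z.1 z.2 y)) origin
  + alpha^-1 * ('D_(u, w) ('D_(v, 0) (fun z => r z.1 z.2 y)) origin * p theta y)
  = (1 - alpha)^-1 * 'D_u ('D_v (p ^~ y)) theta
    - 'D_u logp theta * 'D_v logp theta * p theta y.
Proof.
have /andP[a0 a1] := alpha01.
have an0 : alpha != 0 by rewrite gt_eqF.
have a1n0 : 1 - alpha != 0 by rewrite gt_eqF// subr_gt0.
rewrite derive2_density_ratio derive2_ratio.
have D2 := derive2_log (model_open Hmodel) psm Ttheta py u v.
have {D2} -> : 'D_u ('D_v (p ^~ y)) theta = 'D_u ('D_v logp) theta * p theta y
  + 'D_u logp theta * 'D_v logp theta * p theta y by rewrite D2 subrK.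
move: (p theta y) ('D_u ('D_v logp) theta) ('D_u logp theta) ('D_v logp theta)
  ('D_w logp theta) => q luv lu lv lw.
by field; rewrite a1n0 an0.
Qed.

End PointwiseRatio.

Lemma criterion_near : \forall z \near (theta, theta),
  criterion (P theta) z =
  (1 - alpha)^-1 * \int[lambda]_y (p z.2 y * r z.1 z.2 y)
  + alpha^-1 * \int[P theta]_y r z.1 z.2 y.
Proof. by apply: filterS near_Theta2 => z [Tz1 Tz2]; exact: criterionE. Qed.

Lemma power_hessian (h k : 'cV[R]_d) i :
  'D_(h, k) ('D_(unit_vec i, 0) (criterion (P theta))) (theta, theta) =
  - (fisher p P theta *m h) i 0.
Proof.
have Ttt : Theta2 (theta, theta) by [].
have hA := power_interchange_model Hpow.
have hB := power_interchange Hpow Ttheta.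
pose A := fun z : 'cV[R]_d * 'cV[R]_d => \int[lambda]_y (p z.2 y * r z.1 z.2 y).
pose B := fun z : 'cV[R]_d * 'cV[R]_d => \int[P theta]_y r z.1 z.2 y.
pose v := (unit_vec i, 0 : 'cV[R]_d); pose u := (h, k).
have [Ai Ad AE] := derive2_under_integral u v Theta2_open hA Ttt.
have [Bi Bd BE] := derive2_under_integral u v Theta2_open hB Ttt.
apply: etrans (near_eq_derive2 u v criterion_near) _.
have near_grad : \forall z \near (theta, theta),
    'D_v (fun z => (1 - alpha)^-1 * A z + alpha^-1 * B z) z =
    (1 - alpha)^-1 * 'D_v A z + alpha^-1 * 'D_v B z.
  apply: filterS near_Theta2 => z Tz; apply: derive_affine.
    by have [] := hA.1 v z Tz.
  by have [] := hB.1 v z Tz.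
apply: etrans (near_eq_derive u near_grad) _.
apply: etrans (derive_affine _ _ Ad Bd) _.
rewrite [X in _ * X + _]AE [X in _ + _ * X]BE.
have Bpi := model_integrable_density Hmodel Ttheta Bi.
rewrite (model_Rintegral_density Hmodel Ttheta Bi).
have cAi := integrable_mull (1 - alpha)^-1 Ai.
have cBi := integrable_mull alpha^-1 Bpi.
rewrite -(RintegralZl _ measurableT Ai) -(RintegralZl _ measurableT Bpi).
rewrite -(RintegralD measurableT cAi cBi).
apply: (Rintegral_bartlett Hmodel Hsmooth (c := (1 - alpha)^-1) Ttheta).
  exact: (integrable_addr cAi cBi).
by move=> y py; rewrite scoreE; exact: superdivergence_derive2.
Qed.

(** The first integral contributes [alpha] times the integral of a derivative
    of the density, which is [0]. *)
Lemma power_score i :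
  'D_(unit_vec i, 0) (criterion (mix 1)) (theta, theta) = score p theta x i 0.
Proof.
have /andP[a0 a1] := alpha01.
have Ttt : Theta2 (theta, theta) by [].
have hA := power_interchange_model Hpow.
pose v := (unit_vec i, 0 : 'cV[R]_d).
have [_ Ai Ad AE] := hA.1 v _ Ttt.
pose A := fun z : 'cV[R]_d * 'cV[R]_d => \int[lambda]_y (p z.2 y * r z.1 z.2 y).
have E : \forall z \near (theta, theta), criterion (mix 1) z =
    (1 - alpha)^-1 * A z + alpha^-1 * r z.1 z.2 x.
  apply: filterS near_Theta2 => z [Tz1 Tz2].
  rewrite /M Rintegral_mixture//; last exact: ratio_integrable.
  rewrite subrr mul0r add0r mul1r.
  rewrite (model_Rintegral_density Hmodel)//; last first.
    exact: ratio_integrable_model.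
  by congr (_ * _ + _); apply: eq_Rintegral => y _; rewrite mulrC.
have rd : derivable (fun z => r z.1 z.2 x) (theta, theta) v.
  have Er : \forall z \near (theta, theta),
      exp_log (p ^~ x) alpha (- alpha) z = r z.1 z.2 x.
    by apply: filterS (near_ratio_exp_log px) => z [].
  apply: (near_eq_derivable Er).
  have [] // := is_derive_exp_log (density_twice_diff Hsmooth x) alpha (- alpha)
    (unit_vec i) 0 Ttheta px Ttheta px.
apply: etrans (near_eq_derive v E) _.
apply: etrans (derive_affine _ _ Ad rd) _.
rewrite [X in _ * X + _]AE derive_ratio// -scoreE mulKf ?gt_eqF//.
have [dvi dv0] := Rintegral_derive_density Hmodel Hsmooth (unit_vec i) Ttheta.
rewrite (@ae_eq_Rintegral _ _ _ lambda _
  (fun y => alpha * 'D_(unit_vec i) (p ^~ y) theta)).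
- by rewrite RintegralZl// dv0 !mulr0 add0r.
- by have /measurable_EFinP := measurable_int _ Ai.
- by have /measurable_EFinP := measurable_int _ (integrable_mull alpha dvi).
- apply: filterS (density_gt0 Hmodel Ttheta) => y py.
  rewrite derive_density_ratio// -mulrA.
  by rewrite (derive_log (density_twice_diff Hsmooth y) Ttheta py).
Qed.

Lemma power_fisher_equation :
  fisher p P theta *m IF T (P theta) x = score p theta x.
Proof.
apply/colP => i; have [k [curve crit]] := power_curve.
have D0 := criterion_diff calQ_mix_model.
have D1 := criterion_diff (calQ_mix_mixture one01).
have crit0 : 'D_(unit_vec i, 0) (criterion (P theta)) (theta, theta) = 0.
  rewrite derive_prodl; apply: derive_local_max.
    apply: (@differentiable_comp _ _ _ _ (fun t => (t, theta))
      (criterion (P theta))); last exact: D0.1.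
    exact: differentiable_pair.
  by apply: filterS near_theta => t Tt /=; rewrite M_diag; exact: M_center_le.
apply: (fisher_equation D0 D1 _ crit0 curve) => //.
- by apply: filterS crit => e [? ?]; split.
- exact: power_hessian.
- exact: power_score.
Qed.

End PowerSuperdivergence.
End Influence.

Theorem corollary2p2p1 (disp : measure_display) (X : measurableType disp)
    (R : realType) (d : nat) (Theta : set 'cV[R]_d)
    (lambda : {sigma_finite_measure set X -> \bar R})
    (p : 'cV[R]_d -> X -> R) (P : 'cV[R]_d -> probability X R)
    (P0 : probability X R) (alpha : R)
    (Ttilde : 'cV[R]_d -> probability X R -> 'cV[R]_d)
    (T T0 : probability X R -> 'cV[R]_d) :
  model Theta lambda p P P0 ->
  smooth_densities Theta lambda p P ->
  0 < alpha < 1 ->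
  power_assumptions Theta lambda p P P0 alpha Ttilde T ->
  mle_assumptions Theta p P P0 T0 ->
  forall (theta : 'cV[R]_d) (x : X), Theta theta -> 0 < p theta x ->
    IF T (P theta) x = IF T0 (P theta) x /\
    IF T0 (P theta) x = invmx (fisher p P theta) *m score p theta x.
Proof.
move=> Hmodel Hsmooth alpha01 Hpow Hmle theta x Ttheta px.
have inverse (h : 'cV[R]_d) : fisher p P theta *m h = score p theta x ->
    h = invmx (fisher p P theta) *m score p theta x.
  by move=> <-; rewrite mulKmx//; exact: fisher_unit Hsmooth _ Ttheta.
have T0E := inverse _ (mle_fisher_equation Hmodel Hsmooth Ttheta px Hmle).
have TE := inverse _
  (power_fisher_equation Hmodel Hsmooth Ttheta px alpha01 Hpow).
by split=> //; rewrite TE T0E.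
Qed.
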